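(* Let $S$ be a countable set, $p(i,j)$ a symmetric random walk transition probability on $S$, $\lambda\in(0,1)$, and $\nu$ a redistribution measure on $[0,1]$ (not depending on the total wealth) with $\int\epsilon\,\nu(d\epsilon)=\tfrac12$. Let $\{x(t):t\ge0\}$ be the wealth distribution model on $[0,\infty)^S$ with these parameters. Then for every initial state $x\in[0,\infty)^S$, every $i\in S$ and every $t\ge0$, $$\mathbb E_x\big(x_i(t)\big)=\mathcal E_i\big(x_{\mathcal X_{(1-\lambda)t}}\big)=\sum_{j\in S}p_{(1-\lambda)t}(i,j)\,x_j$$ (as an identity in $[0,\infty]$), where $p_t(i,j)$ is the transition probability of the continuous-time random walk $\mathcal X_t$. As a consequence, if $\mu$ is an invariant probability measure of the model and $\rho_i=\int x_i\,\mu(dx)$ (assumed finite for all $i\in S$), then $\rho$ is harmonic for $p$, i.e. $$\sum_{j\in S}p(i,j)\,\rho_j=\rho_i\qquad\text{for all } i\in S.$$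
   Context: A symmetric random walk transition probability on $S$ is a function $p:S\times S\to[0,\infty)$ with $p(i,j)=p(j,i)$ and $\sum_{j\in S}p(i,j)=1$ for all $i$. $\{\mathcal X_t:t\ge0\}$ is the continuous-time random walk on $S$ jumping at rate one according to $p(i,j)$; $\mathcal E_i$ is its expectation when started at $i$, and $p_t(i,j)$ its transition probability. A redistribution measure is an absolutely continuous probability measure $\nu$ on $[0,1]$ with full support. For $\lambda,\epsilon\in[0,1]$ and $(u,v)\in[0,\infty)^2$ let $$T^\lambda_\epsilon(u,v)=\big(\lambda u+(1-\lambda)\epsilon(u+v),\ \lambda v+(1-\lambda)(1-\epsilon)(u+v)\big).$$ For $x\in[0,\infty)^S$ and $i\ne j$ in $S$, $T^{ij}_{\lambda,\epsilon}(x)$ is the configuration obtained from $x$ by replacing the pair $(x_i,x_j)$ by $T^\lambda_\epsilon(x_i,x_j)$ and leaving all other coordinates unchanged. The wealth distribution model is the Markov process on $[0,\infty)^S$ with generator, on bounded continuous functions depending on finitely many coordinates, $$\mathcal L^\lambda f(x)=\sum_{i,j\in S,\ i\neq j}p(i,j)\int\big(f(T^{ij}_{\lambda,\epsilon}x)-f(x)\big)\,\nu(d\epsilon),$$ the sum being over ordered pairs; that is, each ordered pair $(i,j)$, $i\ne j$, has an independent Poisson clock of rate $p(i,j)$, and whenever it rings $x$ is replaced by $T^{ij}_{\lambda,\epsilon}(x)$ with a fresh independent $\epsilon\sim\nu$. (Each site is involved in updates at total rate at most $2$, so this construction determines the process also for infinite $S$: almost surely each $x_i(t)$ depends on only finitely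 many updates and initial coordinates.) $\mathbb E_x$ is the expectation in this process started from $x$. A probability measure $\mu$ is invariant if $x(0)\sim\mu$ implies $x(t)\sim\mu$ for all $t\ge0$. *)

(* Defs.v *)
From HB Require Import structures.
From mathcomp Require Import all_boot all_order all_algebra.
From mathcomp Require Import all_classical all_reals all_analysis.
From mathcomp Require Import measurable_realfun.

Set Implicit Arguments.
Unset Strict Implicit.
Unset Printing Implicit Defensive.

Import Order.TTheory GRing.Theory Num.Theory.
Import numFieldNormedType.Exports.

Local Open Scope classical_set_scope.
Local Open Scope ring_scope.

Definition symmetric_rw (R : realType) (S : countType) (p : S -> S -> R) :=
  [/\ forall i j, 0 <= p i j,
      forall i j, p i j = p j i &
      forall i, \esum_(j in [set: S]) (p i j)%:E = 1%E].

Definition redistribution_measure (R : realType)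
    (nu : probability (measurableTypeR R) R) :=
  [/\ nu `[0%R, 1%R]%classic = 1%E,
      nu `<< lebesgue_measure &
      forall U : set R, open U -> U `&` `[0, 1] !=set0 ->
        (0 < nu (U `&` `[0%R, 1%R]))%E].

(* A Markov process with values in the measurable set D, given by its laws
   Pr x for the initial states x in D.  Nothing is assumed on Pr x when x is
   not in D, nor on X t when t < 0. *)
Record markov_process (R : realType) d (T : measurableType d) (D : set T)
    d' (Om : measurableType d') (Pr : T -> probability Om R) (X : R -> Om -> T)
    : Prop := MarkovProcess {
  mp_measurable : forall t : R, 0 <= t -> measurable_fun [set: Om] (X t) ;
  mp_values : forall t : R, 0 <= t -> forall w, D (X t w) ;
  mp_kernel : forall A, measurable A -> measurable_fun D (fun x => Pr x A : \bar R) ;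
  mp_start : forall x, D x -> Pr x [set w | X 0 w = x] = 1%E ;
  mp_markov : forall x (s t : R) A B, D x -> 0 <= s -> 0 <= t ->
    <<s [set X u @^-1` C | u in `[0, s] & C in measurable] >> A ->
    measurable B ->
    Pr x (A `&` X (s + t) @^-1` B) =
      (\int[Pr x]_(w in A) Pr (X s w) (X t @^-1` B))%E }.

Definition invariant_measure (R : realType) d (T : measurableType d)
    (D : set T) d' (Om : measurableType d') (Pr : T -> probability Om R)
    (X : R -> Om -> T) (mu : probability T R) :=
  mu D = 1%E /\
  forall (t : R) B, 0 <= t -> measurable B ->
    (\int[mu]_(x in D) Pr x (X t @^-1` B))%E = mu B.

Definition coordinate_preimages (R : realType) (S : countType) :
    set (set (S -> R)) :=
  [set (fun x => x i) @^-1` B | i in [set: S] & B in @measurable _ R].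

(* S -> R with the product sigma-algebra; wealth configurations are the
   elements of [nonneg_config]. *)
Notation config R S := (g_sigma_algebraType (@coordinate_preimages R S)).

Definition nonneg_config (R : realType) (S : countType) : set (config R S) :=
  [set x | forall i, 0 <= x i].

Definition redistribute (R : realType) (lam e : R) (uv : R * R) : R * R :=
  (lam * uv.1 + (1 - lam) * e * (uv.1 + uv.2),
   lam * uv.2 + (1 - lam) * (1 - e) * (uv.1 + uv.2)).

Definition update (R : realType) (S : countType) (lam e : R) (i j : S)
    (x : config R S) : config R S :=
  fun k => if k == i then (redistribute lam e (x i, x j)).1
           else if k == j then (redistribute lam e (x i, x j)).2
           else x k.

Definition depends_on_finitely_many (R : realType) (S : countType)
    (f : config R S -> R) :=
  exists A : seq S, forall x y,
    nonneg_config x -> nonneg_config y ->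
    (forall i, i \in A -> x i = y i) -> f x = f y.

(* Only the values of f on [nonneg_config] matter. *)
Record test_function (R : realType) (S : countType) (f : config R S -> R)
    : Prop := TestFunction {
  tf_bounded : exists M, forall x, nonneg_config x -> `|f x| <= M ;
  tf_continuous : {within (@nonneg_config R S : set {ptws S -> R}),
                     continuous (f : {ptws S -> R} -> R)} ;
  tf_finite : depends_on_finitely_many f }.

(* The sum over ordered pairs is the difference of the sums of the positive and
   of the negative parts of the terms: for a test function f it converges
   absolutely, because only pairs meeting a fixed finite set contribute. *)
Definition generator (R : realType) (S : countType) (p : S -> S -> R) (lam : R)
    (nu : probability (measurableTypeR R) R) (f : config R S -> R)
    (x : config R S) : R :=
  let term (z : S * S) : \bar R :=
    (p z.1 z.2 *
     \int[nu]_(e in `[0, 1]) (f (update lam e z.1 z.2 x) - f x))%:E in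
  fine (esum [set z | z.1 != z.2] (term^\+)%E
        - esum [set z | z.1 != z.2] (term^\-)%E)%E.

(* [generator f] is the derivative at time 0 of t |-> E_x f(X t), uniformly in
   the initial state x. *)
Definition wealth_model (R : realType) (S : countType) (p : S -> S -> R)
    (lam : R) (nu : probability (measurableTypeR R) R)
    d (Om : measurableType d) (Pr : config R S -> probability Om R)
    (X : R -> Om -> config R S) :=
  markov_process (@nonneg_config R S) Pr X /\
  forall f, test_function f ->
    {uniform @nonneg_config R S,
      (fun (t : R) (x : config R S) =>
         t^-1 * (\int[Pr x]_w f (X t w) - f x)) @ 0^'+
      --> generator p lam nu f}.

(* W t = Y (N t), where under Q i the process N is a Poisson process of rate
   one, Y is a Markov chain with transition matrix p started at i, and N and Y
   are independent.  The three facts are packed in the product formula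
   [rw_law] for the joint law of increments of N over consecutive intervals
   [tau l, tau l.+1] and of the beginning of the path of Y. *)
Record walk_representation (R : realType) (S : countType) (p : S -> S -> R)
    d (Om : measurableType d) (Q : S -> probability Om R) (W : R -> Om -> S)
    (N : R -> Om -> nat) (Y : nat -> Om -> S) : Prop := WalkRepresentation {
  rw_jumps : forall (t : R) w, 0 <= t -> W t w = Y (N t w) w ;
  rw_measurable_clock : forall (t : R) m, 0 <= t -> measurable [set w | N t w = m] ;
  rw_measurable_chain : forall n j, measurable [set w | Y n w = j] ;
  rw_clock0 : forall w, N 0 w = 0%N ;
  rw_clock_nondecreasing : forall w (s t : R), 0 <= s -> s <= t ->
    (N s w <= N t w)%N ;
  rw_clock_right_continuous : forall w (t : R), 0 <= t ->
    \forall s \near t^'+, N s w = N t w ;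
  rw_law : forall (i : S) (k n : nat) (tau : nat -> R) (m : nat -> nat)
      (y : nat -> S),
    tau 0%N = 0 -> {homo tau : a b / (a <= b)%N >-> a <= b} ->
    Q i [set w | (forall l, (l < k)%N ->
                    N (tau l.+1) w = (N (tau l) w + m l)%N) /\
                 (forall l, (l <= n)%N -> Y l w = y l)] =
    ((\prod_(l < k) (expR (- (tau l.+1 - tau l))
                     * (tau l.+1 - tau l) ^+ m l / (m l)`!%:R))
     * ((y 0%N == i)%:R * \prod_(l < n) p (y l) (y l.+1)))%:E }.

Definition continuous_time_walk (R : realType) (S : countType)
    (p : S -> S -> R) d (Om : measurableType d) (Q : S -> probability Om R)
    (W : R -> Om -> S) :=
  exists N Y, walk_representation p Q W N Y.

Definition transition_probability (R : realType) (S : countType)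
    d (Om : measurableType d) (Q : S -> probability Om R) (W : R -> Om -> S)
    (t : R) (i j : S) : \bar R :=
  Q i [set w | W t w = j].

(* Main.v *)
(* Let P be the averaging operator of p and K = (1 + lam)/2 + (1 - lam)/2 P.
   The truncated coordinates y |-> min(y_i, C) are test functions; as min(., C) is
   concave and subadditive, the generator L satisfies, with r = 2 / (1 - lam),
     2 K min(y, C/2) (i) <= L min(y_i, C) + 2 min(y_i, C) <= 2 K min(y, r C) (i).
   By the Markov property this bounds the time derivative of E_x min(X_t(i), C)
   by the same means at other truncation levels, with a damping term -2, and an
   induction on n compares these means, from below and from above, with the first
   n terms of the series of e^(2t(K - 1)).  Removing the truncation gives, also
   when both sides are infinite,
     E_x X_t(i) = sum_m e^(-2t) (2t)^m / m! (K^m x)(i),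
   and 2 (K - 1) = (1 - lam) (P - 1) identifies the right-hand side with the
   semigroup of the walk at time (1 - lam) t.  If mu is invariant, then
   rho = e^(2t(K - 1)) rho for all t >= 0.  Letting t -> 0 gives K rho <= rho;
   then K^m rho <= K rho for all m >= 1, whence rho <= K rho, so K rho = rho,
   that is, P rho = rho. *)
Require Import Defs.
From HB Require Import structures.
From mathcomp Require Import all_boot all_order all_algebra.
From mathcomp Require Import all_classical all_reals all_analysis.
From mathcomp Require Import measurable_realfun.
From mathcomp Require Import ring lra.

Set Implicit Arguments.
Unset Strict Implicit.
Unset Printing Implicit Defensive.

Import Order.TTheory GRing.Theory Num.Theory.
Import numFieldNormedType.Exports.

(** The obstacle is that the generator is given only on bounded functions of finitely many
    coordinates, whereas [x i] is unbounded and its mean may be infinite. Truncation makes the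
    generator applicable but destroys closure, since every truncation level is controlled by another
    one. Nonnegative series with moving levels therefore take the place of a uniqueness argument for
    a linear equation. The rate is 2 because the ordered pairs (i, j) and (j, i) have separate
    clocks; the rates sum to 1 in each role once the diagonal, where nothing moves, is added.
    Separating the damping -2 from the gain leaves a gain that is monotone under K, so an induction
    hypothesis can be averaged by K. The factor r is the reciprocal of (1 - lam)/2, the smaller of
    the two weights in an averaged update: one input above r C already lifts the average to C. The
    derivative is one-sided, at time 0, but uniform in the state. Integrated over the law of [X s]
    it controls forward increments uniformly in s, and the comparison lemmas are built for functions
    known only in this way. *)

Local Open Scope classical_set_scope.
Local Open Scope ring_scope.

(** * Countable sums and averaging operators *)

Section countable_sums.
Local Open Scope ereal_scope.
Variables (R : realType) (S : countType).
Implicit Types (a : S -> \bar R).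

(** Enumerating S by [pickle], with the value 0 at codes of no element, transfers results on series
    and on the counting measure to sums over S. *)
Lemma esum_pickle a : (forall j, 0 <= a j) ->
  \esum_(j in [set: S]) a j = \sum_(n <oo) oapp a 0 (pickle_inv n).
Proof.
move=> a0; have b0 n : 0 <= oapp a 0 (@pickle_inv S n).
  by case: pickle_inv => //= j; exact: a0.
rewrite nneseries_esumT// (esumID (pickle @` [set: S]))// !setTI.
rewrite [X in _ = _ + X]esum1 ?adde0; last first.
  move=> n /=; have := @pickle_invK S n; case: pickle_inv => //= j jn Hn.
  by exfalso; apply: Hn; exists j.
rewrite esum_image; last by move=> i j _ _; exact: (pcan_inj pickleK).
by apply: eq_esum => j _; rewrite /= pickleK_inv.
Qed.

Lemma esumZl (c : R) a : (0 <= c)%R -> (forall j, 0 <= a j) ->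
  \esum_(j in [set: S]) (c%:E * a j) = c%:E * \esum_(j in [set: S]) a j.
Proof.
move=> c0 a0; rewrite !esum_pickle//; last by move=> j; rewrite mule_ge0.
rewrite -nneseriesZl; first by apply: eq_eseriesr => n _; case: pickle_inv => //=; rewrite mule0.
by move=> n _; case: pickle_inv => //= j; exact: a0.
Qed.

Lemma esum_delta (i : S) (a : S -> \bar R) : (forall j, 0 <= a j) ->
  \esum_(j in [set: S]) ((j == i)%:R%:E * a j) = a i.
Proof.
move=> a0.
rewrite -[RHS](esum_set1 (a0 i)) [RHS]esum_mkcond.
apply: eq_esum => j _; have -> : (j \in [set i]%classic) = (j == i).
  by apply/idP/eqP; rewrite inE.
by case: eqP => [->|_]; rewrite ?mul1e ?mul0e.
Qed.

Lemma esum_esum_comm (T : choiceType) (a : S -> T -> \bar R) :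
  (forall i j, 0 <= a i j) ->
  \esum_(i in [set: S]) \esum_(j in [set: T]) a i j =
  \esum_(j in [set: T]) \esum_(i in [set: S]) a i j.
Proof.
move=> a0; rewrite !esum_esum//.
rewrite (reindex_esum ([set: T] `*`` fun=> [set: S]) _ (fun x => (x.2, x.1)))//.
split=> //=.
  by move=> [i1 i2] [j1 j2] /= _ _ [] -> ->.
by move=> [i1 i2] _ /=; exists (i2, i1).
Qed.

(** Monotone convergence for the counting measure. *)
Lemma esum_cvg (a : nat -> S -> \bar R) (b : S -> \bar R) :
  (forall n j, 0 <= a n j) ->
  (forall j, {homo a^~ j : n m / (n <= m)%N >-> n <= m}) ->
  (forall j, a n j @[n --> \oo] --> b j) ->
  \esum_(j in [set: S]) a n j @[n --> \oo] --> \esum_(j in [set: S]) b j.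
Proof.
move=> a0 nda acvg.
have b0 j : 0 <= b j.
  rewrite -(cvg_lim _ (acvg j))//; apply: lime_ge; first exact: cvgP (acvg j).
  exact: nearW.
pose c n k := oapp (a n) 0 (@pickle_inv S k).
have c0 n k : 0 <= c n k by rewrite /c; case: pickle_inv => //= j; exact: a0.
have toint (h : S -> \bar R) : (forall j, 0 <= h j) -> \esum_(j in [set: S]) h j =
    \int[counting]_k oapp h 0 (@pickle_inv S k).
  move=> h0; rewrite esum_pickle// ge0_integral_count// => k.
  by case: pickle_inv => //= j; exact: h0.
rewrite toint//; under eq_fun do rewrite toint//.
rewrite (_ : (fun t => oapp b 0 _) = fun t => limn (c^~ t)); last first.
  apply/funext => k; rewrite /c; case: pickle_inv => [j|] /=.
    exact/esym/cvg_lim.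
  by rewrite lim_cst.
apply: cvg_monotone_convergence => //.
by move=> k _ n m nm; rewrite /c; case: pickle_inv => //= j; exact: nda.
Qed.

Lemma esumMr (c : \bar R) a : 0 <= c -> (forall j, 0 <= a j) ->
  \esum_(j in [set: S]) (a j * c) = (\esum_(j in [set: S]) a j) * c.
Proof.
move=> c0 a0; rewrite muleC !esum_pickle//; last by move=> j; rewrite mule_ge0.
have b0 n : 0 <= oapp a 0 (@pickle_inv S n).
  by case: pickle_inv => //= j; exact: a0.
rewrite -[in RHS]ge0_integral_count// -ge0_integralZl// ge0_integral_count.
  by apply: eq_eseriesr => n _; case: pickle_inv => [j|] /=;
    rewrite ?mule0// muleC.
by move=> n; rewrite mule_ge0.
Qed.

Lemma measurable_esum d (T : measurableType d) (D : set T)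
    (f : S -> T -> \bar R) : measurable D ->
  (forall j, measurable_fun D (f j)) -> (forall j x, D x -> 0 <= f j x) ->
  measurable_fun D (fun x => \esum_(j in [set: S]) f j x).
Proof.
move=> mD mf f0.
pose c n (x : T) := oapp (f^~ x) 0 (@pickle_inv S n).
apply: (@eq_measurable_fun _ _ _ _ _ (fun x => \sum_(n <oo) c n x)).
  move=> x /[!inE] Dx; rewrite [RHS](_ : _ = \esum_(j in [set: S]) maxe (f j x) 0).
    rewrite esum_pickle => [|j]; last by rewrite le_max lexx orbT.
    apply: eq_eseriesr => n _; rewrite /c; case: pickle_inv => //= j.
    by apply/esym/max_idPl; exact: f0.
  by apply: eq_esum => j _; apply/esym/max_idPl; exact: f0.
apply: ge0_emeasurable_sum => [n x Dx _|n _]; rewrite /c.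
  by case: pickle_inv => //= j; exact: f0.
by case: pickle_inv => [j|] /=; [exact: mf|exact: measurable_cst].
Qed.

Lemma integral_esum d (T : measurableType d) (mu : {measure set T -> \bar R})
    (D : set T) (f : S -> T -> \bar R) : measurable D ->
  (forall j, measurable_fun D (f j)) -> (forall j x, D x -> 0 <= f j x) ->
  \int[mu]_(x in D) (\esum_(j in [set: S]) f j x) =
  \esum_(j in [set: S]) \int[mu]_(x in D) f j x.
Proof.
move=> mD mf f0.
pose c n (x : T) := oapp (f^~ x) 0 (@pickle_inv S n).
transitivity (\int[mu]_(x in D) \sum_(n <oo) c n x).
  apply: eq_integral => x /[!inE] Dx.
  rewrite [LHS](_ : _ = \esum_(j in [set: S]) maxe (f j x) 0).
    rewrite esum_pickle => [|j]; last by rewrite le_max lexx orbT.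
    apply: eq_eseriesr => n _; rewrite /c; case: pickle_inv => //= j.
    by apply/max_idPl; exact: f0.
  by apply: eq_esum => j _; apply/esym/max_idPl; exact: f0.
rewrite integral_nneseries//; last 2 first.
- by move=> n; rewrite /c; case: pickle_inv => [j|] /=; [exact: mf|exact: measurable_cst].
- by move=> n x Dx; rewrite /c; case: pickle_inv => //= j; exact: f0.
rewrite esum_pickle; last by move=> j; apply: integral_ge0 => x; exact: f0.
apply: eq_eseriesr => n _; rewrite /c; case: pickle_inv => //=.
by rewrite integral0.
Qed.

End countable_sums.

(** Extended real values keep the average meaningful for configurations that are not summable
    against k i. *)
Definition kapply (R : realType) (S : countType) (k : S -> S -> R)
    (h : S -> \bar R) (i : S) : \bar R :=
  (\esum_(j in [set: S]) ((k i j)%:E * h j))%E.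

Section kapply_theory.
Local Open Scope ereal_scope.
Variables (R : realType) (S : countType) (k : S -> S -> R).
Hypothesis k_ge0 : forall i j, (0 <= k i j)%R.
Implicit Types (h g : S -> \bar R) (n : nat).

Lemma kapply_ge0 h i : (forall j, 0 <= h j) -> 0 <= kapply k h i.
Proof. by move=> h0; apply: esum_ge0 => j _; rewrite mule_ge0// lee_fin. Qed.

Lemma iter_kapply_ge0 n h i : (forall j, 0 <= h j) ->
  0 <= iter n (kapply k) h i.
Proof. by move=> h0; elim: n i => //= n IH i; exact: kapply_ge0. Qed.

Lemma le_kapply h g i : (forall j, h j <= g j) -> kapply k h i <= kapply k g i.
Proof. by move=> hg; apply: le_esum => j _; rewrite lee_wpmul2l// lee_fin. Qed.

Lemma le_iter_kapply n h g i : (forall j, h j <= g j) ->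
  iter n (kapply k) h i <= iter n (kapply k) g i.
Proof. by move=> hg; elim: n i => //= n IH i; exact: le_kapply. Qed.

Lemma kapplyD h g i : (forall j, 0 <= h j) -> (forall j, 0 <= g j) ->
  kapply k (fun j => h j + g j) i = kapply k h i + kapply k g i.
Proof.
move=> h0 g0; rewrite -esumD => [|j _|j _]; last 2 first.
- by rewrite mule_ge0// lee_fin.
- by rewrite mule_ge0// lee_fin.
by apply: eq_esum => j _; rewrite ge0_muleDr.
Qed.

Lemma kapplyZ (c : R) h i : (0 <= c)%R -> (forall j, 0 <= h j) ->
  kapply k (fun j => c%:E * h j) i = c%:E * kapply k h i.
Proof.
move=> c0 h0; rewrite -esumZl// => [|j]; last by rewrite mule_ge0// lee_fin.
by apply: eq_esum => j _; rewrite muleCA.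
Qed.

Lemma kapply_sum (I : choiceType) (r : seq I) (f : I -> S -> \bar R) i :
  (forall l j, 0 <= f l j) ->
  kapply k (fun j => \sum_(l <- r) f l j) i = \sum_(l <- r) kapply k (f l) i.
Proof.
move=> f0.
transitivity (\esum_(j in [set: S]) \sum_(l <- r) (k i j)%:E * f l j).
  by apply: eq_esum => j _; rewrite ge0_sume_distrr.
by rewrite esum_sum// => j l _ _; rewrite mule_ge0// lee_fin.
Qed.

Lemma kapply_esum (T : countType) (f : T -> S -> \bar R) i :
  (forall l j, 0 <= f l j) ->
  kapply k (fun j => \esum_(l in [set: T]) f l j) i =
  \esum_(l in [set: T]) kapply k (f l) i.
Proof.
move=> f0; rewrite /kapply [RHS]esum_esum_comm => [|l j]; last first.
  by rewrite mule_ge0// lee_fin.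
by apply: eq_esum => j _; rewrite esumZl.
Qed.

Lemma iter_kapply_esum (T : countType) (f : T -> S -> \bar R) n i :
  (forall l j, 0 <= f l j) ->
  iter n (kapply k) (fun j => \esum_(l in [set: T]) f l j) i =
  \esum_(l in [set: T]) iter n (kapply k) (f l) i.
Proof.
move=> f0; elim: n i => //= n IH i.
rewrite -kapply_esum => [|l j]; last exact: iter_kapply_ge0.
by congr (kapply k _ i); apply/funext => j; rewrite IH.
Qed.

Lemma iter_kapplyZ n (c : R) h i : (0 <= c)%R -> (forall j, 0 <= h j) ->
  iter n (kapply k) (fun j => c%:E * h j) i = c%:E * iter n (kapply k) h i.
Proof.
move=> c0 h0; elim: n i => //= n IH i.
rewrite -kapplyZ// => [|j]; last exact: iter_kapply_ge0.
by congr (kapply k _ i); apply/funext => j; rewrite IH.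
Qed.

Lemma iter_kapply_cvg (a : nat -> S -> \bar R) (b : S -> \bar R) n i :
  (forall l j, 0 <= a l j) ->
  (forall j, {homo a^~ j : l m / (l <= m)%N >-> l <= m}) ->
  (forall j, a l j @[l --> \oo] --> b j) ->
  iter n (kapply k) (a l) i @[l --> \oo] --> iter n (kapply k) b i.
Proof.
move=> a0 nda acvg; elim: n i => //= n IH i; apply: esum_cvg.
- by move=> l j; rewrite mule_ge0 ?lee_fin ?iter_kapply_ge0.
- move=> j l m lm; apply: lee_wpmul2l; first by rewrite lee_fin.
  by apply: le_iter_kapply => j'; exact: nda.
- by move=> j; apply: cvgeZl => //; exact: IH.
Qed.

Lemma measurable_iter_kapply d (T : measurableType d) (D : set T)
    (f : T -> S -> \bar R) n i : measurable D ->
  (forall j, measurable_fun D (f^~ j)) -> (forall x j, D x -> 0 <= f x j) ->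
  measurable_fun D (fun x => iter n (kapply k) (f x) i).
Proof.
move=> mD mf f0; elim: n i => //= n IH i.
apply: measurable_esum => // [j|j x Dx].
  by apply: emeasurable_funM => //; exact: measurable_cst.
by rewrite mule_ge0 ?lee_fin// iter_kapply_ge0// => j'; exact: f0.
Qed.

(** Tonelli, once for each application of k. *)
Lemma integral_iter_kapply d (T : measurableType d)
    (mu : {measure set T -> \bar R}) (D : set T) (f : T -> S -> \bar R) n i :
  measurable D ->
  (forall j, measurable_fun D (f^~ j)) -> (forall x j, D x -> 0 <= f x j) ->
  \int[mu]_(x in D) iter n (kapply k) (f x) i =
  iter n (kapply k) (fun j => \int[mu]_(x in D) f x j) i.
Proof.
move=> mD mf f0; elim: n i => //= n IH i.
have h0 x j : D x -> 0 <= iter n (kapply k) (f x) j.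
  by move=> Dx; apply: iter_kapply_ge0 => j'; exact: f0.
have mh j : measurable_fun D (fun x => iter n (kapply k) (f x) j).
  exact: measurable_iter_kapply.
rewrite integral_esum// => [|j|j x Dx]; last 2 first.
- by apply: emeasurable_funM => //; exact: measurable_cst.
- by rewrite mule_ge0 ?lee_fin ?h0.
apply: eq_esum => j _; rewrite ge0_integralZl ?lee_fin// ?IH//.
by move=> x Dx; exact: h0.
Qed.

Section stochastic.
Hypothesis k_sum1 : forall i, \esum_(j in [set: S]) (k i j)%:E = 1.

Lemma kapply_cst (c : R) i : (0 <= c)%R -> kapply k (fun=> c%:E) i = c%:E.
Proof.
move=> c0; rewrite /kapply; under eq_esum do rewrite muleC.
by rewrite esumZl ?k_sum1 ?mule1// => j; rewrite lee_fin.
Qed.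

Lemma iter_kapply_le n (c : R) h i : (0 <= c)%R -> (forall j, h j <= c%:E) ->
  iter n (kapply k) h i <= c%:E.
Proof.
move=> c0 hc; elim: n i => //= n IH i.
by rewrite (le_trans (le_kapply _ IH))// kapply_cst.
Qed.

End stochastic.
End kapply_theory.

(** * Differential inequalities with damping *)

Section comparison.
Variable R : realType.
Implicit Types (u v dv b psi : R -> R) (s e h t d r : R).

(* A step that contracts psi by 1 - 2h and errs by at most 2eh keeps psi above
   the barrier -e, whatever the value of e > 0. *)
Lemma damped_ge0 psi :
  0 <= psi 0 ->
  (forall s e, 0 < s -> 0 < e -> exists2 d : R, 0 < d &
     forall r, 0 <= r -> s - d < r < s -> psi r <= psi s + e) ->
  (forall s e, 0 <= s -> 0 < e -> exists2 d : R, 0 < d &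
     forall h, 0 < h < d -> (1 - 2 * h) * psi s - e * h <= psi (s + h)) ->
  forall t, 0 <= t -> 0 <= psi t.
Proof.
move=> psi0 left_cont step t t0.
suff main e : 0 < e -> - e <= psi t.
  rewrite leNgt; apply/negP => psit.
  by have := main (- psi t / 2); lra.
move=> e0.
(* [A] holds the times up to which the barrier is respected. Its supremum inherits the barrier by
   [left_cont], and [step] would carry it further if it were smaller than t. *)
pose A := [set s | 0 <= s <= t /\ forall r, 0 <= r <= s -> - e <= psi r].
have A0 : A 0 by split=> [|r r0]; [lra|have -> : r = 0 by lra]; lra.
have ubA : has_ubound A by exists t => s [/andP[]].
have neA : A !=set0 by exists 0.
set s0 := sup A.
have s00 : 0 <= s0 by exact: ub_le_sup.
have s0t : s0 <= t by apply: ge_sup => // s [/andP[]].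
have below r : 0 <= r -> r < s0 -> - e <= psi r.
  move=> r0 rs0; have [s [_ sA] rs] := sup_gt neA rs0.
  by apply: sA; rewrite r0 ltW.
have at_s0 : - e <= psi s0.
  have [s0_gt0|] := ltP 0 s0; last first.
    by move=> s0_le0; have -> : s0 = 0; lra.
  rewrite leNgt; apply/negP => psis0.
  have [|d d0 Hd] := left_cont s0 ((- e - psi s0) / 2) s0_gt0; first by lra.
  pose r := Num.max (s0 / 2) (s0 - d / 2).
  have r0 : 0 <= r by rewrite le_max; apply/orP; left; lra.
  have rs0 : r < s0 by rewrite gt_max; apply/andP; split; lra.
  have dr : s0 - d < r by rewrite lt_max; apply/orP; right; lra.
  have := Hd r r0; rewrite dr rs0 => /(_ isT).
  by have := below r r0 rs0; lra.
have upto r : 0 <= r <= s0 -> - e <= psi r.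
  by case/andP=> r0; rewrite le_eqVlt => /predU1P[->//|]; exact: below.
have [s0_lt_t|] := ltP s0 t; last first.
  by move=> ts0; have -> : t = s0; lra.
have [|d d0 Hd] := step s0 (2 * e) s00; first by lra.
(* Since m <= 1/2, the factor 1 - 2h is nonnegative during the whole step; multiplying psi s0 + e >=
   0 by it absorbs the error 2eh. *)
pose m := Num.min d (Num.min 1 (t - s0)) / 2.
have [m0 md m1 mt] : [/\ 0 < m, m < d, 2 * m <= 1 & s0 + m <= t].
  have lo : 0 < Num.min d (Num.min 1 (t - s0)).
    by rewrite !lt_min d0 ltr01 subr_gt0 s0_lt_t.
  have h1 : Num.min d (Num.min 1 (t - s0)) <= d by rewrite ge_min lexx.
  have h2 : Num.min d (Num.min 1 (t - s0)) <= 1 by rewrite !ge_min lexx !orbT.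
  have h3 : Num.min d (Num.min 1 (t - s0)) <= t - s0.
    by rewrite !ge_min lexx !orbT.
  by rewrite /m; split; lra.
suff /(ub_le_sup ubA) : A (s0 + m) by rewrite -/s0; lra.
split=> [|r /andP[r0 rm]]; first by lra.
have [rs0|s0r] := leP r s0; first by apply: upto; rewrite r0.
have hr : 0 < r - s0 < d by lra.
have := Hd _ hr; rewrite (_ : s0 + (r - s0) = r); last by lra.
have : 0 <= (1 - 2 * (r - s0)) * (psi s0 + e) by rewrite mulr_ge0; lra.
nra.
Qed.

Lemma is_derive_right_bound v (s dvs e : R) : is_derive s 1 v dvs -> 0 < e ->
  exists2 d : R, 0 < d & forall h, 0 < h < d -> `|v (s + h) - v s - h * dvs| <= e * h.
Proof.
move=> [vs <-] e0.
have /cvgrPdist_le /(_ _ e0) := vs.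
rewrite near_withinE => -[d /= d0 Hd]; exists d => // h /andP[h0 hd].
have := Hd h; rewrite /= sub0r normrN gtr0_norm// => /(_ hd); rewrite gt_eqF// => /(_ isT).
rewrite [h *: 1]mulr1 [h + s]addrC => H.
have {}H : `|'D_1 v s - h^-1 * (v (s + h) - v s)| <= e by exact: H.
have -> : v (s + h) - v s - h * 'D_1 v s
          = - (h * ('D_1 v s - h^-1 * (v (s + h) - v s))).
  by field; rewrite gt_eqF.
by rewrite normrN normrM gtr0_norm// mulrC ler_pM2r.
Qed.

Lemma is_derive_left_cont v (s dvs e : R) : is_derive s 1 v dvs -> 0 < e ->
  exists2 d : R, 0 < d & forall r, `|r - s| < d -> `|v r - v s| <= e.
Proof.
move=> [/derivable1_diffP/differentiable_continuous vs _] e0.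
have /cvgrPdist_le /(_ _ e0) [d /= d0 Hd] := vs.
by exists d => // r rs; rewrite distrC; apply: Hd; rewrite /= distrC.
Qed.

(** No derivative of u is available. The Lipschitz bound supplies left continuity, and b >= dv + 2v
    turns the forward increments of u - v into a contraction by 1 - 2h. *)
Lemma damped_comparison u b v dv (M d0 : R) :
  0 < d0 ->
  (forall s h, 0 <= s -> 0 < h < d0 -> `|u (s + h) - u s| <= M * h) ->
  (forall e, 0 < e -> exists2 d : R, 0 < d & forall s h, 0 <= s -> 0 < h < d ->
     u s + h * (b s - 2 * u s) - e * h <= u (s + h)) ->
  (forall s : R, 0 <= s -> is_derive s 1 v (dv s)) ->
  (forall s, 0 <= s -> dv s + 2 * v s <= b s) ->
  v 0 <= u 0 ->
  forall t, 0 <= t -> v t <= u t.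
Proof.
move=> d00 lip ustep dvE vb vu0 t t0.
have M0 : 0 <= M.
  have hh : 0 < d0 / 2 < d0 by lra.
  have := lip 0 (d0 / 2) (lexx 0) hh; have := normr_ge0 (u (0 + d0 / 2) - u 0).
  by nra.
rewrite -subr_ge0; apply: (@damped_ge0 (fun t => u t - v t)) t0.
- by rewrite subr_ge0.
- move=> s e s0 e0.
  have e20 : 0 < e / 2 by lra.
  have [d1 d10 H1] := is_derive_left_cont (dvE s (ltW s0)) e20.
  have M10 : 0 < M + 1 by lra.
  (* [M + 1] instead of [M] keeps this quotient positive when M = 0. *)
  exists (Num.min d1 (Num.min d0 (e / 2 / (M + 1)))).
    by rewrite !lt_min d10 d00 divr_gt0.
  move=> r r0 /andP[].
  (* The Lipschitz bound is used from the earlier time r = s - h, hence its uniformity in the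
     starting time. *)
  have [h rE] : {h | r = s - h} by exists (s - r); lra.
  rewrite rE => + hs.
  have : s - h < s by []. rewrite ltrBlDr ltrDl => h0.
  rewrite ltrD2l ltrN2 !lt_min => /and3P[hd1 hd0 he].
  have := lip (s - h) h; rewrite -rE r0 => /(_ isT); rewrite h0 hd0 => /(_ isT).
  rewrite {1}rE subrK => /ler_normlP[H2 _].
  have := H1 r; rewrite rE addrAC subrr add0r normrN gtr0_norm// => /(_ hd1).
  move=> /ler_normlP[H3 _]; move: H2 H3; rewrite rE.
  have : (M + 1) * h <= e / 2.
    by move: he; rewrite ltr_pdivlMr// mulrC => /ltW.
  lra.
- move=> s e s0 e0.
  have e20 : 0 < e / 2 by lra.
  have [d1 d10 H1] := is_derive_right_bound (dvE s s0) e20.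
  have [d2 d20 H2] := ustep _ e20.
  exists (Num.min d1 d2); first by rewrite lt_min d10.
  move=> h /andP[h0]; rewrite lt_min => /andP[hd1 hd2].
  have := H1 h; rewrite h0 hd1 => /(_ isT) /ler_normlP[_ H3].
  have := H2 s h s0; rewrite h0 hd2 => /(_ isT) H4.
  have : h * (dv s + 2 * v s) <= h * b s by rewrite ler_pM2l// vb.
  lra.
Qed.

Lemma damped_comparison_le u b v dv (M d0 : R) :
  0 < d0 ->
  (forall s h, 0 <= s -> 0 < h < d0 -> `|u (s + h) - u s| <= M * h) ->
  (forall e, 0 < e -> exists2 d : R, 0 < d & forall s h, 0 <= s -> 0 < h < d ->
     u (s + h) <= u s + h * (b s - 2 * u s) + e * h) ->
  (forall s : R, 0 <= s -> is_derive s 1 v (dv s)) ->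
  (forall s, 0 <= s -> b s <= dv s + 2 * v s) ->
  u 0 <= v 0 ->
  forall t, 0 <= t -> u t <= v t.
Proof.
move=> d00 lip ustep dvE vb uv0 t t0; rewrite -lerN2.
apply: (@damped_comparison (\- u) (\- b) (\- v) (\- dv) M d0) => //=.
- by move=> s h s0 hd; rewrite -opprD normrN lip.
- move=> e /ustep[d d_gt0 H]; exists d => // s h s0 hd.
  by have := H s h s0 hd; lra.
- by move=> s s0; apply: is_deriveN; exact: dvE.
- by move=> s s0; have := vb s s0; lra.
- by rewrite lerN2.
Qed.

End comparison.

(** The rate c is a parameter because three rates occur: 2 for the model, 1 - lam once lazy steps
    are discarded, and 1 for the walk. *)
Definition poisson_weight (R : realType) (c : R) (m : nat) (t : R) : R :=
  expR (- (c * t)) * (c * t) ^+ m / m`!%:R.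

Section poisson_weight_theory.
Variable R : realType.

Lemma poisson_weight_ge0 (c : R) m t : 0 <= c -> 0 <= t ->
  0 <= poisson_weight c m t.
Proof.
move=> c0 t0; rewrite /poisson_weight mulr_ge0 ?invr_ge0//.
by rewrite mulr_ge0 ?expR_ge0// exprn_ge0// mulr_ge0.
Qed.

Lemma poisson_weight_at0 (c : R) m : poisson_weight c m 0 = (m == 0%N)%:R.
Proof.
rewrite /poisson_weight mulr0 oppr0 expR0 mul1r expr0n.
by case: m => [|m]; rewrite ?fact0 ?invr1 ?mulr1// mul0r.
Qed.

(** The forward equation of the Poisson process, with weight 0 before m = 0. *)
Lemma is_derive_poisson_weight (c : R) m (t : R) :
  is_derive t 1 (poisson_weight c m)
    (c * ((if m is m'.+1 then poisson_weight c m' t else 0)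
          - poisson_weight c m t)).
Proof.
have dlin : is_derive t 1 ( *%R c) c.
  by rewrite -[X in is_derive _ _ _ X]mulr1; exact: is_deriveZ.
have dexp : is_derive t 1 (expR \o \- *%R c) (expR (- (c * t)) * (- c)).
  by apply: is_derive1_comp; exact: is_deriveN.
have dpow := is_deriveX m dlin.
have dprod := is_deriveZ (m`!%:R^-1) (is_deriveM dexp dpow).
rewrite (_ : poisson_weight c m =
  m`!%:R^-1 \*: ((expR \o \- *%R c) * (( *%R c) ^+ m))); last first.
  by apply/funext => r; rewrite /poisson_weight !fctE mulrC. 
apply: (is_derive_eq dprod).
rewrite /= /poisson_weight; case: m {dpow dprod} => [|m].
  rewrite fact0 /= !fctE !expr0 /GRing.scale /=.
  by rewrite invr1; ring.
rewrite factS natrM /= !fctE /GRing.scale /= exprS.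
have m0 : m.+1%:R != 0 :> R by rewrite pnatr_eq0.
have f0 : m`!%:R != 0 :> R by rewrite pnatr_eq0 -lt0n fact_gt0.
move: (m.+1%:R : R) (m`!%:R : R) m0 f0 => M F M0 F0.
by field; rewrite M0 F0.
Qed.

End poisson_weight_theory.

(** * The generator on truncated coordinates *)

Section sums_over_pairs.
Local Open Scope ereal_scope.
Variables (R : realType) (S : countType).

(** An off-diagonal pair through i is (i, j) or (j, i) for exactly one j != i, and contributes [a j]
    or [b j] accordingly. *)
Lemma esum_pairs_through (i : S) (a b : S -> \bar R) :
  (forall j, 0 <= a j) -> (forall j, 0 <= b j) ->
  \esum_(z in [set z : S * S | z.1 != z.2])
     (if z.1 == i then a z.2 else if z.2 == i then b z.1 else 0) =
  \esum_(j in [set: S]) (if j == i then 0 else a j + b j).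
Proof.
move=> a0 b0; rewrite esum_mkcond.
(* Vanishing at i lets the two families of pairs be summed over the full product: the diagonal then
   adds nothing. *)
pose a' (j : S) := if j == i then 0 else a j.
pose b' (j : S) := if j == i then 0 else b j.
have a'0 j : 0 <= a' j by rewrite /a'; case: ifP.
have b'0 j : 0 <= b' j by rewrite /b'; case: ifP.
have d0 (j l : S) (x : \bar R) : 0 <= x -> 0 <= (j == l)%:R%:E * x.
  by move=> x0; rewrite mule_ge0.
transitivity (\esum_(z in [set: S] `*`` (fun=> [set: S]))
   ((z.1 == i)%:R%:E * a' z.2 + (z.2 == i)%:R%:E * b' z.1)).
  rewrite (_ : [set: S] `*`` _ = [set: S * S]); last first.
    by apply/seteqP; split.
  apply: eq_esum => -[x y] _ /=; rewrite /a' /b'.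
  have -> : ((x, y) \in [set z : S * S | z.1 != z.2]) = (x != y).
    by apply/idP/idP; rewrite inE.
  have [->|xi] := eqVneq x i; have [->|yi] := eqVneq y i; rewrite ?eqxx.
  - by rewrite !mule0 adde0.
  - by rewrite /= mulr1n mul1e mule0 adde0.
  - by rewrite xi /= mulr1n mul1e mule0 add0e.
  - by rewrite /= !mulr0n !mul0e adde0; case: ifP.
rewrite -(esum_esum (a := fun x y => (x == i)%:R%:E * a' y + (y == i)%:R%:E * b' x)); last first.
  by move=> x y _ _; rewrite adde_ge0// d0.
transitivity (\esum_(x in [set: S]) ((x == i)%:R%:E * (\esum_(y in [set: S]) a' y) + b' x)).
  apply: eq_esum => x _; rewrite esumD => [|y _|y _]; [|exact: d0|exact: d0].
  by rewrite esum_delta// esumZl.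
rewrite esumD => [|y _|y _]; [|by rewrite mule_ge0// esum_ge0|by []].
rewrite esum_delta => [|_]; last exact: esum_ge0.
rewrite -esumD//; apply: eq_esum => j _; rewrite /a' /b'.
by case: ifP; rewrite ?adde0.
Qed.

(** Since k sums to 1, adding 2c cancels the -c of both pairs made of i and j, for every j != i; at
    j = i, which belongs to no pair, the amount 2c k i survives. The result is a sum of nonnegative
    terms. *)
Lemma signed_sum_through (k : S -> R) (i : S) (a b : S -> R) (c M : R)
    (t : S * S -> \bar R) :
  (forall j, (0 <= k j)%R) -> \esum_(j in [set: S]) (k j)%:E = 1 ->
  (0 <= c)%R -> (forall j, (0 <= a j <= M)%R) -> (forall j, (0 <= b j <= M)%R) ->
  (forall z, z.1 != z.2 -> t z =
     if z.1 == i then (k z.2 * (a z.2 - c))%:E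
     else if z.2 == i then (k z.1 * (b z.1 - c))%:E else 0) ->
  (fine (esum [set z | z.1 != z.2] t^\+ - esum [set z | z.1 != z.2] t^\-))%:E
    + (2 * c)%:E =
  \esum_(j in [set: S])
     ((k j)%:E * (if j == i then 2 * c else a j + b j)%:E).
Proof.
move=> k0 k1 c0 a0M b0M tE.
(* t = s - r with s and r nonnegative and summable, so the positive and negative
   parts of t may be traded for s and r. *)
pose s z := if z.1 == i then (k z.2 * a z.2)%:E
            else if z.2 == i then (k z.1 * b z.1)%:E else 0.
pose r z := if z.1 == i then (k z.2 * c)%:E
            else if z.2 == i then (k z.1 * c)%:E else 0.
have s0 z : 0 <= s z.
  rewrite /s; case: ifP => _; last case: ifP => _ //; rewrite lee_fin mulr_ge0//.
    by case/andP: (a0M z.2).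
  by case/andP: (b0M z.1).
have r0 z : 0 <= r z.
  by rewrite /r; case: ifP => _; last case: ifP => _ //; rewrite lee_fin mulr_ge0.
have tsr z : z.1 != z.2 -> t z = s z - r z.
  move=> /tE ->; rewrite /s /r; case: ifP => _; last case: ifP => _.
  - by rewrite mulrBr.
  - by rewrite mulrBr.
  - by rewrite sube0.
have fsr z : s z \is a fin_num /\ r z \is a fin_num.
  by rewrite /s /r; case: ifP => // _; case: ifP.
set N := [set z : S * S | z.1 != z.2].
pose s' := \esum_(j in [set: S]) (if j == i then 0 else (k j * a j)%:E + (k j * b j)%:E).
pose r' := \esum_(j in [set: S]) (if j == i then 0 else (k j * c)%:E + (k j * c)%:E).
have sE : esum N s = s'.
  by apply: esum_pairs_through => j; rewrite lee_fin mulr_ge0//;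
    [case/andP: (a0M j)|case/andP: (b0M j)].
have rE : esum N r = r'.
  by apply: esum_pairs_through => j; rewrite lee_fin mulr_ge0.
have M0 : (0 <= M)%R by case/andP: (a0M i) => /le_trans H /H.
have finbound (g h : S -> R) (B : R) : (0 <= B)%R ->
    (forall j, (0 <= g j <= B)%R) -> (forall j, (0 <= h j <= B)%R) ->
    \esum_(j in [set: S]) (if j == i then 0 else (k j * g j)%:E + (k j * h j)%:E)
      \is a fin_num.
  move=> B0 gB hB; rewrite ge0_fin_numE; last first.
    apply: esum_ge0 => j _; case: ifP => // _; rewrite -EFinD lee_fin.
    by rewrite addr_ge0// mulr_ge0//; [case/andP: (gB j)|case/andP: (hB j)].
  apply: (@le_lt_trans _ _ (\esum_(j in [set: S]) ((2 * B)%:E * (k j)%:E))).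
    apply: le_esum => j _; case: ifP => _.
      by rewrite -EFinM lee_fin mulr_ge0// mulr_ge0.
    rewrite -EFinD -EFinM lee_fin -mulrDr mulrC ler_wpM2r//.
    by move: (gB j) (hB j); lra.
  rewrite esumZl => [||j]; last by rewrite lee_fin.
    by rewrite k1 mule1 ltry.
  by rewrite mulr_ge0.
have s'fin : s' \is a fin_num by exact: (finbound a b M).
have r'fin : r' \is a fin_num.
  by apply: (finbound (fun=> c) (fun=> c) c) => // j; rewrite c0 lexx.
have ps : esum N t^\+ <= esum N s.
  apply: le_esum => z Nz; rewrite funeposE tsr// ge_max s0 andbT.
  by rewrite leeBlDr ?leeDl//; case: (fsr z).
have pr : esum N t^\- <= esum N r.
  apply: le_esum => z Nz; rewrite funenegE tsr// ge_max r0 andbT.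
  case: (fsr z) => sf rf; rewrite fin_num_oppeB// addeC leeBlDr//.
  by rewrite leeDl.
(* Pointwise t = s - r means t^+ + r = t^- + s, an identity between nonnegative terms that may be
   summed; finiteness of the four sums then permits subtraction. *)
have bal : esum N t^\+ + esum N r = esum N t^\- + esum N s.
  rewrite -!esumD; do ?by move=> z _;
    first [exact: funepos_ge0|exact: funeneg_ge0|exact: r0|exact: s0].
  apply: eq_esum => z Nz.
  rewrite -/(s z) -/(r z) funeposE funenegE tsr//; case: (fsr z).
  move: (s0 z) (r0 z); move: (s z) (r z) => [x| |] [y| |]//; rewrite !lee_fin => x0 y0 _ _.
  rewrite -EFinB /= -!EFin_max. rewrite -!EFinD; congr _%:E.
  rewrite /Num.max; case: ifP => xy; case: ifP => yx; lra.
have pfin : esum N t^\+ \is a fin_num.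
  rewrite ge0_fin_numE; last exact: esum_ge0.
  by rewrite (le_lt_trans ps)// sE ltey_eq s'fin.
have nfin : esum N t^\- \is a fin_num.
  rewrite ge0_fin_numE; last exact: esum_ge0.
  by rewrite (le_lt_trans pr)// rE ltey_eq r'fin.
have diff : esum N t^\+ - esum N t^\- = s' - r'.
  move: bal; rewrite sE rE; move: pfin nfin s'fin r'fin.
  move: (esum N t^\+) (esum N t^\-) s' r' {sE rE} => [x| |] [y| |] [z| |] [w| |]//= _ _ _ _.
  by rewrite -!EFinD => -[e]; congr _%:E; lra.
rewrite diff fineK; last by rewrite fin_numB s'fin.
have sumr : r' + (2 * c * k i)%:E = (2 * c)%:E.
  rewrite -[RHS]mule1 -k1 -esumZl ?mulr_ge0//.
  rewrite -[X in _ + X = _](@esum_delta _ _ i (fun j => (2 * c * k j)%:E)); last first.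
    by move=> j; rewrite lee_fin !mulr_ge0.
  rewrite -esumD => [|j _|j _]; last 2 first.
  - by case: ifP => // _; rewrite -EFinD lee_fin addr_ge0// mulr_ge0.
  - by rewrite mule_ge0// lee_fin !mulr_ge0.
  apply: eq_esum => j _; case: eqP => _; rewrite ?mul1e ?mul0e ?add0e ?adde0//.
  by rewrite -EFinD -EFinM; congr _%:E; lra.
have sums : s' + (2 * c * k i)%:E =
    \esum_(j in [set: S]) ((k j)%:E * (if j == i then 2 * c else a j + b j)%:E).
  rewrite -[X in _ + X = _](@esum_delta _ _ i (fun j => (2 * c * k j)%:E)); last first.
    by move=> j; rewrite lee_fin !mulr_ge0.
  rewrite -esumD => [|j _|j _]; last 2 first.
  - case: ifP => // _; rewrite -EFinD lee_fin addr_ge0// mulr_ge0//.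
      by case/andP: (a0M j).
    by case/andP: (b0M j).
  - by rewrite mule_ge0// lee_fin !mulr_ge0.
  apply: eq_esum => j _; case: eqP => _; rewrite ?mul1e ?mul0e ?add0e ?adde0//.
    by rewrite -EFinM; congr _%:E; lra.
  by rewrite -EFinD -EFinM; congr _%:E; lra.
rewrite -sums -sumr; move: s'fin r'fin.
move: s' r' {sE rE diff sumr sums} => [x| |] [y| |]//= _ _.
by rewrite -!EFinD; congr _%:E; lra.
Qed.

End sums_over_pairs.

Section redistribution_average.
Variables (R : realType) (nu : probability (measurableTypeR R) R).
Hypothesis nu_redistribution : redistribution_measure nu.
Hypothesis nu_mean : 'E_nu[fun e : R => e]%E = (2^-1)%:E.

Let I01 : set (measurableTypeR R) := `[0%R, 1%R]%classic.

Let mI01 : measurable I01.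
Proof. exact: measurable_itv. Qed.

Let nuI01 : (nu : {measure set _ -> \bar R}) I01 = 1%E.
Proof. by case: nu_redistribution. Qed.

Lemma bounded_redistribution_integrable (f : R -> R) (M : R) :
  measurable_fun [set: R] f -> (forall e, 0 <= e <= 1 -> `|f e| <= M) ->
  nu.-integrable I01 (EFin \o f).
Proof.
move=> mf fM; apply: measurable_bounded_integrable => //.
- by rewrite nuI01 ltry.
- exact: measurable_funS mf.
- exists M; split; first exact: num_real.
  move=> N MN e; rewrite /I01 /= in_itv /= => e01.
  by rewrite (le_trans (fM _ e01))// ltW.
Qed.

(** The mean is taken over the whole line, but the complement of [0, 1] is null for [nu]. *)
Lemma Rintegral_redistribution_id : \int[nu]_(e in `[0, 1]) e = 2^-1.
Proof.
rewrite /Rintegral (_ : integral _ _ _ = (2^-1)%:E)//.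
rewrite -nu_mean unlock integral_mkcond; apply: ae_eq_integral => //.
- apply/(measurable_restrictT _ mI01); exact: measurable_funTS.
- exists (~` I01); split.
  + exact: measurableC.
  + apply: (etrans (probability_setC nu mI01)).
    by rewrite [X in (_ - X)%E](_ : _ = 1%E) ?subee//; exact: nuI01.
  + move=> e /= H eI; apply: H => _.
    by rewrite /patch mem_set.
Qed.

Lemma Rintegral_redistribution_affine (a b : R) :
  \int[nu]_(e in `[0, 1]) (a + b * e) = a + b / 2.
Proof.
rewrite RintegralD//.
- rewrite Rintegral_cst// nuI01 mulr1 RintegralZl//.
    by rewrite Rintegral_redistribution_id.
  apply: (@bounded_redistribution_integrable _ 1) => // e e01.
  by rewrite ger0_norm; lra.
- by apply: (@bounded_redistribution_integrable _ `|a|).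
- apply: (@bounded_redistribution_integrable _ `|b|).
    exact: measurable_funM.
  move=> e e01; rewrite normrM -[leRHS]mulr1 ler_wpM2l// ger0_norm; lra.
Qed.

Let mtrunc (a b C : R) : measurable_fun [set: R] (fun e : R => Num.min (a + b * e) C).
Proof.
by apply: measurable_minr => //; apply: measurable_funD.
Qed.

Let trunc_integrable (a b C : R) : 0 <= C ->
  (forall e, 0 <= e <= 1 -> 0 <= a + b * e) ->
  nu.-integrable I01 (EFin \o (fun e : R => Num.min (a + b * e) C)).
Proof.
move=> C0 ab0; apply: (@bounded_redistribution_integrable _ C) => // e e01.
by rewrite ger0_norm ?ge_min ?lexx ?orbT// le_min C0 ab0.
Qed.

Let affine_integrable (a b : R) :
  nu.-integrable I01 (EFin \o (fun e : R => a + b * e)).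
Proof.
apply: (@bounded_redistribution_integrable _ (`|a| + `|b|)) => [|e e01].
  exact: measurable_funD.
rewrite (le_trans (ler_normD _ _))// lerD2l normrM -[leRHS]mulr1 ler_wpM2l//.
rewrite ger0_norm; lra.
Qed.

(** The mean of [nu] determines the integrals of affine functions, so the truncated value is bounded
    through an affine minorant. *)
Lemma Rintegral_redistribution_trunc_ge (a b a' b' C : R) : 0 <= C ->
  (forall e, 0 <= e <= 1 -> 0 <= a + b * e) ->
  (forall e, 0 <= e <= 1 -> a' + b' * e <= Num.min (a + b * e) C) ->
  a' + b' / 2 <= \int[nu]_(e in `[0, 1]) Num.min (a + b * e) C.
Proof.
move=> C0 ab0 ab'; rewrite -Rintegral_redistribution_affine.
by apply: le_Rintegral => //; exact: trunc_integrable.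
Qed.

(** Jensen's inequality, from the two affine majorants whose minimum is the integrand. *)
Lemma Rintegral_redistribution_trunc_le (a b C : R) : 0 <= C ->
  (forall e, 0 <= e <= 1 -> 0 <= a + b * e) ->
  \int[nu]_(e in `[0, 1]) Num.min (a + b * e) C <= Num.min (a + b / 2) C.
Proof.
move=> C0 ab0; rewrite le_min; apply/andP; split.
  rewrite -Rintegral_redistribution_affine.
  apply: le_Rintegral => //; do ?exact: trunc_integrable.
  by move=> e _; rewrite ge_min lexx.
rewrite [leRHS](_ : C = \int[nu]_(e in `[0, 1]) (C + 0 * e)); last first.
  by rewrite Rintegral_redistribution_affine mul0r addr0.
apply: le_Rintegral => //; do ?exact: trunc_integrable.
by move=> e _; rewrite mul0r addr0 ge_min lexx orbT.
Qed.

Lemma Rintegral_redistribution_truncB (a b C c : R) : 0 <= C ->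
  (forall e, 0 <= e <= 1 -> 0 <= a + b * e) ->
  \int[nu]_(e in `[0, 1]) (Num.min (a + b * e) C - c) =
  \int[nu]_(e in `[0, 1]) Num.min (a + b * e) C - c.
Proof.
move=> C0 ab0; rewrite RintegralB//.
- by rewrite Rintegral_cst// nuI01 mulr1.
- exact: trunc_integrable.
- by apply: (@bounded_redistribution_integrable _ `|c|).
Qed.

End redistribution_average.

(* Since epsilon has mean 1/2, an update replaces x i on average by
   (1 + lam) / 2 * x i + (1 - lam) / 2 * x j. *)
Definition lazy_kernel (R : realType) (S : countType) (lam : R)
    (p : S -> S -> R) (i j : S) : R :=
  (1 + lam) / 2 * (j == i)%:R + (1 - lam) / 2 * p i j.

Section lazy_kernel_theory.
Variables (R : realType) (S : countType) (lam : R) (p : S -> S -> R).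
Hypotheses (p_rw : symmetric_rw p) (lam01 : 0 < lam < 1).

Lemma lazy_kernel_ge0 i j : 0 <= lazy_kernel lam p i j.
Proof.
case: p_rw => p0 _ _.
have a0 : 0 <= (1 + lam) / 2 by case/andP: lam01 => *; lra.
have b0 : 0 <= (1 - lam) / 2 by case/andP: lam01 => *; lra.
by rewrite /lazy_kernel addr_ge0// mulr_ge0.
Qed.

Lemma kapply_lazy_kernel (h : S -> \bar R) i : (forall j, 0 <= h j)%E ->
  kapply (lazy_kernel lam p) h i =
  (((1 + lam) / 2)%:E * h i + ((1 - lam) / 2)%:E * kapply p h i)%E.
Proof.
case: p_rw => p0 _ _ h0.
have a0 : 0 <= (1 + lam) / 2 by case/andP: lam01 => *; lra.
have b0 : 0 <= (1 - lam) / 2 by case/andP: lam01 => *; lra.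
rewrite -[X in (_ = _ * X + _)%E](esum_delta i h0).
rewrite -!esumZl//.
- rewrite -esumD => [|j _|j _].
  + apply: eq_esum => j _.
    rewrite !muleA -!EFinM -ge0_muleDl -?EFinD// lee_fin mulr_ge0//.
  + by rewrite !mule_ge0// lee_fin.
  + by rewrite !mule_ge0// lee_fin.
- by move=> j; rewrite mule_ge0// lee_fin.
- by move=> j; rewrite mule_ge0// lee_fin.
Qed.

Lemma lazy_kernel_sum1 i :
  (\esum_(j in [set: S]) (lazy_kernel lam p i j)%:E = 1)%E.
Proof.
have := @kapply_lazy_kernel (fun=> 1%E) i.
rewrite /kapply; under eq_esum do rewrite mule1.
move=> -> //; under eq_esum do rewrite mule1.
by case: p_rw => _ _ ->; rewrite !mule1 -EFinD; congr _%:E; field.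
Qed.

End lazy_kernel_theory.

(** * The truncated means along the process *)

Section integral_mixture.
Local Open Scope ereal_scope.
Context d1 d2 d3 d4 (T : measurableType d1) (Om : measurableType d2)
  (Om' : measurableType d3) (V : measurableType d4) (R : realType).
Variables (mu : {measure set T -> \bar R}) (D : set T)
  (kap : T -> {measure set Om -> \bar R}) (Y : Om -> V)
  (rho : {measure set Om' -> \bar R}) (Z : Om' -> V).
Hypotheses (mD : measurable D) (mY : measurable_fun [set: Om] Y)
  (mZ : measurable_fun [set: Om'] Z).
Hypothesis mkap : forall B, measurable B ->
  measurable_fun D (fun w => kap w (Y @^-1` B)).
Hypothesis mix : forall B, measurable B ->
  \int[mu]_(w in D) kap w (Y @^-1` B) = rho (Z @^-1` B).

Import HBNNSimple.

(** The values r of h are nonnegative, so [Num.max r 0] is r on its range; it makes the coefficient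
    nonnegative for every real r, as the exchange of sum and integral demands. *)
Let integral_nnsfun_comp d (U : measurableType d)
    (m : {measure set U -> \bar R}) (W : U -> V) (h : {nnsfun V >-> R}) :
  measurable_fun [set: U] W ->
  \int[m]_w (h (W w))%:E =
  \sum_(r \in range h) (Num.max r 0)%:E * m (W @^-1` (h @^-1` [set r])).
Proof.
move=> mW.
have mWB B : measurable B -> measurable (W @^-1` B).
  by move=> mB; rewrite -[_ @^-1` _]setTI; exact: mW.
transitivity (\int[m]_w \sum_(r \in range h)
    ((Num.max r 0)%:E * (\1_(W @^-1` (h @^-1` [set r])) w)%:E)).
  apply: eq_integral => w _; rewrite fimfunE -fsumEFin//.
  apply: eq_fsbigr => r; rewrite inE => -[v _ <-].
  by rewrite EFinM; congr (_%:E * _); apply/esym/max_idPl.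
rewrite ge0_integral_fsum//.
- apply: eq_fsbigr => r _; rewrite ge0_integralZl ?lee_fin ?le_max ?lexx ?orbT//.
  + by rewrite integral_indic ?setIT//; exact: mWB.
  + by apply/measurable_EFinP; apply: measurable_indic; exact: mWB.
- move=> r; apply: measurable_funeM; apply/measurable_EFinP.
  by apply: measurable_indic; exact: mWB.
- by move=> r w _; rewrite mule_ge0 ?lee_fin ?le_max ?lexx ?orbT.
Qed.

Let measurable_nnsfun_mixture (h : {nnsfun V >-> R}) :
  measurable_fun D (fun w => \int[kap w]_y (h (Y y))%:E).
Proof.
under eq_fun do rewrite integral_nnsfun_comp//.
apply: emeasurable_fsum => // r.
by apply: measurable_funeM; exact: mkap.
Qed.

Let integral_nnsfun_mixture (h : {nnsfun V >-> R}) :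
  \int[rho]_w (h (Z w))%:E = \int[mu]_(w in D) \int[kap w]_y (h (Y y))%:E.
Proof.
under [RHS]eq_integral do rewrite integral_nnsfun_comp//.
rewrite ge0_integral_fsum//.
- rewrite integral_nnsfun_comp//; apply: eq_fsbigr => r _.
  rewrite -mix// ge0_integralZl// ?lee_fin ?le_max ?lexx ?orbT//.
  exact: mkap.
- by move=> r; apply: measurable_funeM; exact: mkap.
- by move=> r w _; rewrite mule_ge0 ?lee_fin ?le_max ?lexx ?orbT.
Qed.

Variable f : V -> \bar R.
Hypotheses (mf : measurable_fun [set: V] f) (f0 : forall v, 0 <= f v).

Let g := nnsfun_approx measurableT mf.

Let g_cvg d (U : measurableType d) (m : {measure set U -> \bar R})
    (W : U -> V) : measurable_fun [set: U] W ->
  \int[m]_w (g n (W w))%:E @[n --> \oo] --> \int[m]_w f (W w).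
Proof.
move=> mW.
rewrite [X in _ --> X](_ : _ = \int[m]_w limn (fun n => (g n (W w))%:E)).
  apply: cvg_monotone_convergence => //.
  - by move=> n; apply/measurable_EFinP; exact: measurableT_comp.
  - by move=> n w _; rewrite lee_fin.
  - by move=> w _ n k nk; rewrite lee_fin; exact/lefP/nd_nnsfun_approx.
apply: eq_integral => w _; apply/esym/cvg_lim => //.
exact: cvg_nnsfun_approx.
Qed.

Lemma measurable_mixture : measurable_fun D (fun w => \int[kap w]_y f (Y y)).
Proof.
apply: (emeasurable_fun_cvg (fun n w => \int[kap w]_y (g n (Y y))%:E)).
  by move=> n; exact: measurable_nnsfun_mixture.
by move=> w _; exact: g_cvg.
Qed.

(** Serves twice: for the Markov property, where the kernel restarts the process at [X s w] and Z is
    [X (s + t)], and for an invariant measure, where the kernel is [Pr] and Z the identity. *)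
Lemma integral_mixture :
  \int[rho]_w f (Z w) = \int[mu]_(w in D) \int[kap w]_y f (Y y).
Proof.
have <- := cvg_lim (@ereal_hausdorff R) (g_cvg (m := rho) mZ).
under eq_fun do rewrite integral_nnsfun_mixture.
rewrite [RHS](_ : _ = \int[mu]_(w in D)
    limn (fun n => \int[kap w]_y (g n (Y y))%:E)); last first.
  by apply: eq_integral => w _; apply/esym/cvg_lim => //; exact: g_cvg.
rewrite monotone_convergence//.
- by move=> n w _; apply: integral_ge0 => y _; rewrite lee_fin.
- move=> w _ n k nk; apply: ge0_le_integral => //.
  + by move=> y _; rewrite lee_fin.
  + by apply/measurable_EFinP; exact: measurableT_comp.
  + by apply/measurable_EFinP; exact: measurableT_comp.
  + by move=> y _; rewrite lee_fin; exact/lefP/nd_nnsfun_approx.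
Qed.

End integral_mixture.

Section truncated_coordinates.
Variables (R : realType) (S : countType).

Lemma measurable_coordinate i :
  measurable_fun [set: config R S] (fun x : config R S => x i).
Proof.
move=> _ B mB; rewrite setTI; apply: sub_sigma_algebra.
by exists i => //; exists B.
Qed.

Lemma measurable_bigcap_countType d (T : measurableType d) (F : S -> set T) :
  (forall i, measurable (F i)) -> measurable (\bigcap_(i in [set: S]) F i).
Proof.
move=> mF; rewrite -[X in measurable X]setCK setC_bigcap; apply: measurableC.
by apply: countable_bigcupT_measurable => // i; exact: measurableC.
Qed.

Lemma measurable_nonneg_config : measurable (@nonneg_config R S).
Proof.
rewrite (_ : @nonneg_config R S =
  \bigcap_(i in [set: S]) ((fun x : config R S => x i) @^-1` `[0, +oo[)).
  apply: measurable_bigcap_countType => i; rewrite -[_ @^-1` _]setTI.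
  exact: measurable_coordinate.
apply/seteqP; split=> x; rewrite /nonneg_config /=.
  by move=> x0 i _; rewrite /= in_itv /= x0.
by move=> x0 i; have := x0 i I; rewrite /= in_itv /= andbT.
Qed.

Lemma test_function_trunc (C : R) i : 0 <= C ->
  test_function (fun y : config R S => Num.min (y i) C).
Proof.
move=> C0; split.
- exists C => x x0; rewrite ger0_norm; first by rewrite ge_min lexx orbT.
  by rewrite le_min x0 C0.
- apply: continuous_subspaceT => x.
  apply: (@continuous_comp {ptws S -> R} R R (fun y => y i) (fun z => Num.min z C)).
    exact: proj_continuous.
  by apply: continuous_min => //; exact: cst_continuous.
- by exists [:: i] => x y _ _ xy; rewrite xy// mem_head.
Qed.

End truncated_coordinates.

Section truncated_generator.
Variables (R : realType) (S : countType) (p : S -> S -> R) (lam : R)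
    (nu : probability (measurableTypeR R) R).
Hypotheses (p_rw : symmetric_rw p) (lam01 : 0 < lam < 1)
    (nu_redistribution : redistribution_measure nu)
    (nu_mean : 'E_nu[fun e : R => e]%E = (2^-1)%:E).

Let J (C a b : R) := \int[nu]_(e in `[0, 1]) Num.min (a + b * e) C.

(** Means over epsilon of the truncated new value at i: [J1] when (i, j) rings, [J2] when (j, i)
    rings and i receives the share 1 - epsilon. Both integrands are truncations of affine functions
    of epsilon. *)
Let J1 (C : R) (y : config R S) i j := J C (lam * y i) ((1 - lam) * (y i + y j)).
Let J2 (C : R) (y : config R S) i j :=
  J C (lam * y i + (1 - lam) * (y j + y i)) (- ((1 - lam) * (y j + y i))).

Let aff_ge0 (y : config R S) i j e : nonneg_config y -> 0 <= e <= 1 ->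
  0 <= lam * y i + (1 - lam) * (y i + y j) * e.
Proof.
move=> y0 /andP[e0 e1]; have [l0 l1] := andP lam01.
have yi := y0 i; have yj := y0 j.
have h1 : 0 <= 1 - lam by lra.
have h2 : 0 <= y i + y j by lra.
by rewrite addr_ge0// mulr_ge0 ?mulr_ge0// ltW.
Qed.

Let aff_ge0' (y : config R S) i j e : nonneg_config y -> 0 <= e <= 1 ->
  0 <= lam * y i + (1 - lam) * (y j + y i) + - ((1 - lam) * (y j + y i)) * e.
Proof.
move=> y0 e01; rewrite mulNr -addrA -[X in _ + (X - _)]mulr1 -mulrBr [y j + _]addrC.
by apply: aff_ge0 => //; lra.
Qed.

(** By symmetry of p the clocks of (i, j) and (j, i) have the same rate, so the two roles of i can
    be collected under the single weight [p i j]. *)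
Lemma generator_trunc (C : R) (y : config R S) i : nonneg_config y -> 0 <= C ->
  ((generator p lam nu (fun y : config R S => Num.min (y i) C) y)%:E
    + (2 * Num.min (y i) C)%:E =
  \esum_(j in [set: S]) ((p i j)%:E *
     (if j == i then 2 * Num.min (y i) C else J1 C y i j + J2 C y i j)%:E))%E.
Proof.
move=> y0 C0; case: p_rw => p0 psym p1.
have Jbd a b : (forall e, 0 <= e <= 1 -> 0 <= a + b * e) -> 0 <= J C a b <= C.
  move=> ab0; apply/andP; split.
    have := @Rintegral_redistribution_trunc_ge _ _ nu_redistribution nu_mean a b 0 0 C C0 ab0.
    rewrite mul0r addr0; apply => e e01.
    by rewrite mul0r addr0 le_min C0 ab0.
  apply: le_trans (Rintegral_redistribution_trunc_le nu_redistribution nu_mean C0 ab0) _.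
  by rewrite ge_min lexx orbT.
apply: (@signed_sum_through _ _ (p i) i (J1 C y i) (J2 C y i) _ C) => //.
- by rewrite le_min y0 C0.
- by move=> j; apply: Jbd => e; exact: aff_ge0.
- by move=> j; apply: Jbd => e; exact: aff_ge0'.
move=> [a b] /= ab; have [ai|ai] := eqVneq a i; last have [bi|bi] := eqVneq b i.
- rewrite ai in ab *; congr (_ * _)%:E.
  rewrite /J1 /J -(Rintegral_redistribution_truncB nu_redistribution _ C0); last first.
    by move=> e; exact: aff_ge0.
  apply: eq_Rintegral => e _; rewrite /update /redistribute /= eqxx.
  by congr (Num.min _ _ - _); ring.
- rewrite bi in ab *; rewrite psym; congr (_ * _)%:E.
  rewrite /J2 /J -(Rintegral_redistribution_truncB nu_redistribution _ C0); last first.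
    by move=> e; exact: aff_ge0'.
  apply: eq_Rintegral => e _; rewrite /update /redistribute /= eqxx eq_sym (negPf ab).
  by congr (Num.min _ _ - _); ring.
(* Neither entry of the pair is i, so the update does not touch the coordinate. *)
- rewrite (_ : \int[nu]_(e in _) _ = 0) ?mulr0//.
  rewrite -[RHS](Rintegral_set0 nu (fun=> 0)).
  rewrite (@eq_Rintegral _ _ _ _ _ (fun=> 0)).
    by rewrite Rintegral_set0 Rintegral_cst// mul0r.
  move=> e _; rewrite /update /redistribute /= eq_sym (negPf ai) eq_sym (negPf bi).
  by rewrite subrr.
Qed.

(** Puts 2K in the form of the sum in [generator_trunc], so that the bounds on the generator reduce
    to comparing terms. *)
Lemma kapply_lazy_trunc (D : R) (y : config R S) i : nonneg_config y -> 0 <= D ->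
  (\esum_(j in [set: S]) ((p i j)%:E * (2 * ((1 + lam) / 2 * Num.min (y i) D
     + (1 - lam) / 2 * Num.min (y j) D))%:E) =
  2%:E * kapply (lazy_kernel lam p) (fun j => (Num.min (y j) D)%:E) i)%E.
Proof.
move=> y0 D0; case: (p_rw) => p0 psym p1.
have [l0 l1] := andP lam01.
have m0 j : 0 <= Num.min (y j) D by rewrite le_min y0 D0.
have a0 : 0 <= (1 + lam) / 2 by lra.
have b0 : 0 <= (1 - lam) / 2 by lra.
rewrite kapply_lazy_kernel//.
transitivity (kapply p (fun j => 2%:E * (((1 + lam) / 2 * Num.min (y i) D)%:E
    + ((1 - lam) / 2)%:E * (Num.min (y j) D)%:E)) i)%E.
  by apply: eq_esum => j _; congr (_ * _)%E; rewrite /= -EFinM -EFinD -EFinM.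
rewrite kapplyZ// => [|j]; last first.
  by rewrite adde_ge0// ?mule_ge0// lee_fin// mulr_ge0.
rewrite kapplyD// => [|j|j]; last 2 first.
- by rewrite lee_fin mulr_ge0.
- by rewrite mule_ge0// lee_fin.
rewrite kapply_cst//; last by rewrite mulr_ge0.
by rewrite kapplyZ.
Qed.

(* Lower bound: both weights lam + (1 - lam) e and (1 - lam) e are at most 1, so
   truncating the two inputs at C / 2 keeps the output below C.  Upper bound:
   Jensen for the concave min(., C), then subadditivity. *)
Lemma generator_trunc_ge (C : R) (y : config R S) i : nonneg_config y -> 0 <= C ->
  (2%:E * kapply (lazy_kernel lam p) (fun j => (Num.min (y j) (C / 2))%:E) i <=
  (generator p lam nu (fun y : config R S => Num.min (y i) C) y)%:E
    + (2 * Num.min (y i) C)%:E)%E.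
Proof.
move=> y0 C0; case: (p_rw) => p0 psym p1.
have [l0 l1] := andP lam01.
rewrite generator_trunc// -kapply_lazy_trunc//; last by lra.
apply: le_esum => j _; rewrite lee_wpmul2l// ?lee_fin//.
set u := Num.min (y i) (C / 2); set v := Num.min (y j) (C / 2).
have ui : u <= y i by rewrite ge_min lexx.
have vj : v <= y j by rewrite ge_min lexx.
have uC : u <= C / 2 by rewrite ge_min lexx orbT.
have vC : v <= C / 2 by rewrite ge_min lexx orbT.
have u0 : 0 <= u by rewrite le_min y0; lra.
have v0 : 0 <= v by rewrite le_min y0; lra.
case: eqP => [ji|_].
  have -> : v = u by rewrite /v ji.
  have : u <= Num.min (y i) C by rewrite le_min ui; lra.
  lra.
have bound e : 0 <= e <= 1 -> lam * u + (1 - lam) * (u + v) * e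
    <= Num.min (lam * y i + (1 - lam) * (y i + y j) * e) C.
  move=> /andP[e0 e1]; rewrite le_min; apply/andP; split.
    by rewrite lerD// ?ler_wpM2r// ler_wpM2l ?lerD// ?subr_ge0 ltW.
  have h1 : lam * u <= lam * C by rewrite (ler_wpM2l (ltW l0))//; lra.
  have h2 : (1 - lam) * (u + v) * e <= (1 - lam) * C.
    rewrite -[leRHS]mulr1 ler_pM ?mulr_ge0 ?ler_wpM2l//; lra.
  lra.
have g1 : (1 + lam) / 2 * u + (1 - lam) / 2 * v <= J1 C y i j.
  rewrite (_ : (1 + lam) / 2 * u + (1 - lam) / 2 * v =
     lam * u + (1 - lam) * (u + v) / 2); last by field.
  apply: (Rintegral_redistribution_trunc_ge nu_redistribution nu_mean C0) => e e01.
    exact: aff_ge0.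
  exact: bound.
have g2 : (1 + lam) / 2 * u + (1 - lam) / 2 * v <= J2 C y i j.
  rewrite (_ : (1 + lam) / 2 * u + (1 - lam) / 2 * v =
     (lam * u + (1 - lam) * (u + v)) + - ((1 - lam) * (u + v)) / 2); last by field.
  apply: (Rintegral_redistribution_trunc_ge nu_redistribution nu_mean C0) => e e01.
    exact: aff_ge0'.
  (* The second entry receives the share 1 - e, so [bound] is used there. *)
  have e01' : 0 <= 1 - e <= 1 by lra.
  have := bound _ e01'; rewrite !le_min => /andP[h1 h2].
  by apply/andP; split; lra.
lra.
Qed.

Lemma generator_trunc_le (C r : R) (y : config R S) i : nonneg_config y ->
  0 <= C -> 1 <= r * ((1 - lam) / 2) ->
  ((generator p lam nu (fun y : config R S => Num.min (y i) C) y)%:E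
    + (2 * Num.min (y i) C)%:E <=
  2%:E * kapply (lazy_kernel lam p) (fun j => (Num.min (y j) (r * C))%:E) i)%E.
Proof.
move=> y0 C0 rb; case: (p_rw) => p0 psym p1.
have [l0 l1] := andP lam01.
have r1 : 1 <= r by nra.
rewrite generator_trunc// -kapply_lazy_trunc//; last by rewrite mulr_ge0//; lra.
have CrC : C <= r * C by rewrite ler_peMl.
apply: le_esum => j _; rewrite lee_wpmul2l// ?lee_fin//.
case: eqP => [->|_].
  have : Num.min (y i) C <= Num.min (y i) (r * C).
    by rewrite le_min !ge_min lexx CrC orbT.
  lra.
(* If both inputs are at most r C, nothing is truncated on the right; an input above r C contributes
   at least C by itself, both weights being at least 1/r. *)
have split_min : Num.min ((1 + lam) / 2 * y i + (1 - lam) / 2 * y j) C <=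
    (1 + lam) / 2 * Num.min (y i) (r * C) + (1 - lam) / 2 * Num.min (y j) (r * C).
  have yi := y0 i; have yj := y0 j.
  have rCb : C <= (1 - lam) / 2 * (r * C) by nra.
  have rCa : C <= (1 + lam) / 2 * (r * C) by nra.
  have rC0 : 0 <= r * C by rewrite mulr_ge0//; lra.
  rewrite ge_min; case: (leP (y i) (r * C)) => hi; case: (leP (y j) (r * C)) => hj.
  - by rewrite lexx.
  - apply/orP; right; nra.
  - apply/orP; right; nra.
  - apply/orP; right; nra.
have g1 : J1 C y i j <= Num.min ((1 + lam) / 2 * y i + (1 - lam) / 2 * y j) C.
  rewrite (_ : (1 + lam) / 2 * y i + (1 - lam) / 2 * y j =
     lam * y i + (1 - lam) * (y i + y j) / 2); last by field.
  apply: (Rintegral_redistribution_trunc_le nu_redistribution nu_mean C0) => e e01.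
  exact: aff_ge0.
have g2 : J2 C y i j <= Num.min ((1 + lam) / 2 * y i + (1 - lam) / 2 * y j) C.
  rewrite (_ : (1 + lam) / 2 * y i + (1 - lam) / 2 * y j =
     (lam * y i + (1 - lam) * (y j + y i)) + - ((1 - lam) * (y j + y i)) / 2); last by field.
  apply: (Rintegral_redistribution_trunc_le nu_redistribution nu_mean C0) => e e01.
  exact: aff_ge0'.
lra.
Qed.

End truncated_generator.

(** One-step estimates are integrated in this subtraction-free form: with nonnegative terms,
    measurability suffices and no integrability has to be proved. *)
Lemma probability_integral_affine_le d (T : measurableType d) (R : realType)
    (P : probability T R) (c e : R) (f1 f2 g1 g2 : T -> \bar R) :
  0 <= c -> 0 <= e ->
  measurable_fun [set: T] f1 -> measurable_fun [set: T] f2 ->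
  measurable_fun [set: T] g1 -> measurable_fun [set: T] g2 ->
  (forall w, 0 <= f1 w)%E -> (forall w, 0 <= f2 w)%E ->
  (forall w, 0 <= g1 w)%E -> (forall w, 0 <= g2 w)%E ->
  (forall w, f1 w + c%:E * f2 w <= g1 w + (c%:E * g2 w + e%:E))%E ->
  (\int[P]_w f1 w + c%:E * \int[P]_w f2 w <=
   \int[P]_w g1 w + (c%:E * \int[P]_w g2 w + e%:E))%E.
Proof.
move=> c0 e0 mf1 mf2 mg1 mg2 f10 f20 g10 g20 le_fg.
have mZ (f : T -> \bar R) : measurable_fun [set: T] f -> measurable_fun [set: T] (fun w => c%:E * f w)%E.
  by move=> mf; exact: measurable_funeM.
have Z0 (f : T -> \bar R) : (forall w, 0 <= f w)%E -> (forall w, 0 <= c%:E * f w)%E.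
  by move=> f0 w; rewrite mule_ge0.
have mce : measurable_fun [set: T] (fun w : T => c%:E * g2 w + e%:E)%E.
  by apply: emeasurable_funD => //; exact: mZ.
rewrite -!ge0_integralZl//.
rewrite -[X in (_ <= _ + (_ + X))%E]mule1 -(probability_setT P) -integral_cst//.
rewrite -(ge0_integralD _ _ (fun w _ => f10 w) mf1 (fun w _ => Z0 _ f20 w) (mZ _ mf2))//.
rewrite -(ge0_integralD _ _ (fun w _ => Z0 _ g20 w) (mZ _ mg2))//.
rewrite -(ge0_integralD _ _ (fun w _ => g10 w) mg1 _ mce)//; last first.
  by move=> w _; rewrite adde_ge0 ?Z0.
apply: ge0_le_integral => //.
- by move=> w _; rewrite adde_ge0 ?Z0.
- by apply: emeasurable_funD => //; exact: mZ.
- exact: emeasurable_funD.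
Qed.

Section truncated_mean.
Variables (R : realType) (S : countType) (p : S -> S -> R) (lam : R)
    (nu : probability (measurableTypeR R) R).
Hypotheses (p_rw : symmetric_rw p) (lam01 : 0 < lam < 1)
    (nu_redistribution : redistribution_measure nu)
    (nu_mean : 'E_nu[fun e : R => e]%E = (2^-1)%:E).
Variables (d : measure_display) (Om : measurableType d)
    (Pr : config R S -> probability Om R) (X : R -> Om -> config R S).
Hypothesis X_model : wealth_model p lam nu Pr X.

Let D : set (config R S) := @nonneg_config R S.
Let K := lazy_kernel lam p.

Definition trunc_mean (C t : R) (x : config R S) (i : S) : \bar R :=
  (\int[Pr x]_w (Num.min (X t w i) C)%:E)%E.

Lemma process_ge0 t w i : 0 <= t -> 0 <= X t w i.
Proof. by case: X_model => mp _ t0; exact: (mp_values mp t0 w i). Qed.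

Lemma measurable_process t : 0 <= t -> measurable_fun [set: Om] (X t).
Proof. by case: X_model => mp _ t0; exact: (mp_measurable mp t0). Qed.

Lemma measurable_process_coordinate t i : 0 <= t ->
  measurable_fun [set: Om] (fun w => X t w i).
Proof.
move=> t0; apply: (measurableT_comp (@measurable_coordinate R S i)).
exact: measurable_process.
Qed.

Lemma measurable_trunc_process C t i : 0 <= t ->
  measurable_fun [set: Om] (fun w => (Num.min (X t w i) C)%:E).
Proof.
move=> t0; apply/measurable_EFinP; apply: measurable_minr => //.
exact: measurable_process_coordinate.
Qed.

Let trunc_ge0 C t w i : 0 <= C -> 0 <= t -> 0 <= Num.min (X t w i) C.
Proof. by move=> C0 t0; rewrite le_min C0 process_ge0. Qed.

Lemma trunc_mean_ge0 C t x i : 0 <= C -> 0 <= t -> (0 <= trunc_mean C t x i)%E.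
Proof. by move=> C0 t0; apply: integral_ge0 => w _; rewrite lee_fin trunc_ge0. Qed.

Lemma trunc_mean_le C t x i : 0 <= C -> 0 <= t -> (trunc_mean C t x i <= C%:E)%E.
Proof.
move=> C0 t0; rewrite -[leRHS]mule1 -(probability_setT (Pr x)) -integral_cst//.
apply: ge0_le_integral => //.
- by move=> w _; rewrite lee_fin trunc_ge0.
- exact: measurable_trunc_process.
- by move=> w _; rewrite lee_fin ge_min lexx orbT.
Qed.

Lemma trunc_mean_fin_num C t x i : 0 <= C -> 0 <= t ->
  trunc_mean C t x i \is a fin_num.
Proof.
move=> C0 t0; rewrite ge0_fin_numE ?trunc_mean_ge0//.
by rewrite (le_lt_trans (trunc_mean_le _ _ C0 t0))// ltry.
Qed.

Lemma trunc_mean0 C x i : 0 <= C -> D x -> trunc_mean C 0 x i = (Num.min (x i) C)%:E.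
Proof.
case: X_model => mp _ C0 Dx.
have start := mp_start mp Dx.
(* Points of the product space are measurable because S is countable. *)
have mA : measurable [set w | X 0 w = x].
  rewrite (_ : [set w | _] = \bigcap_(i in [set: S]) [set w | X 0 w i = x i]).
    apply: measurable_bigcap_countType => j.
    rewrite -[[set w | _]]setTI.
    exact: (measurable_process_coordinate j (lexx 0) measurableT (measurable_set1 (x j))).
  apply/seteqP; split=> w /= H; first by move=> j _ /=; rewrite H.
  by apply/funext => j; exact: (H j I).
rewrite -[RHS]mule1 -(probability_setT (Pr x)) -integral_cst//.
apply: ae_eq_integral => //; first exact: measurable_trunc_process.
exists (~` [set w | X 0 w = x]); split.
- exact: measurableC.
- apply: (etrans (probability_setC (Pr x) mA)).
  by rewrite [X in (_ - X)%E](_ : _ = 1%E) ?subee.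
- by move=> w /= H eX; apply: H => _; rewrite eX.
Qed.

Lemma markov_integral (f : config R S -> \bar R) (s t : R) x :
  measurable_fun [set: config R S] f -> (forall y, 0 <= f y)%E ->
  D x -> 0 <= s -> 0 <= t ->
  measurable_fun [set: Om] (fun w => \int[Pr (X s w)]_w' f (X t w'))%E /\
  (\int[Pr x]_w f (X (s + t) w) =
   \int[Pr x]_w \int[Pr (X s w)]_w' f (X t w'))%E.
Proof.
case: X_model => mp _ mf f0 Dx s0 t0.
have st0 : 0 <= s + t by rewrite addr_ge0.
have mX B u : 0 <= u -> measurable B -> measurable (X u @^-1` B).
  by move=> u0 mB; rewrite -[_ @^-1` _]setTI; exact: measurable_process.
have mkap B : measurable B ->
    measurable_fun [set: Om] (fun w => Pr (X s w) (X t @^-1` B)).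
  (* The kernel is measurable on [D], which the process never leaves. *)
  move=> mB; apply: (@measurable_comp _ _ _ _ _ _ D (fun x => Pr x (X t @^-1` B))).
  - exact: measurable_nonneg_config.
  - by move=> _ [w _ <-]; exact: (mp_values mp).
  - by apply: (mp_kernel mp); exact: mX.
  - exact: measurable_process.
have mix B : measurable B -> (\int[Pr x]_w Pr (X s w) (X t @^-1` B) =
    Pr x (X (s + t) @^-1` B))%E.
  move=> mB.
  have sT : <<s [set X u @^-1` C | u in `[0, s] & C in measurable] >> setT.
    set G := [set _ | _ in _ & _ in _].
    by have := sigma_algebraCD (@sigma_algebra0 Om setT G); rewrite setD0.
  have <- := mp_markov mp Dx s0 t0 sT mB.
  by rewrite setTI.
split.
  exact: (measurable_mixture (measurable_process t0) mkap mf f0).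
exact: (integral_mixture measurableT (measurable_process t0)
  (measurable_process st0) mkap mix mf f0).
Qed.

Lemma trunc_mean_markov C (s t : R) x i : 0 <= C -> D x -> 0 <= s -> 0 <= t ->
  measurable_fun [set: Om] (fun w => trunc_mean C t (X s w) i) /\
  trunc_mean C (s + t) x i = (\int[Pr x]_w trunc_mean C t (X s w) i)%E.
Proof.
move=> C0 Dx s0 t0.
(* The maximum with 0 is invisible along the process and makes f nonnegative on configurations with
   negative entries as well. *)
pose f (y : config R S) := (Num.max (Num.min (y i) C) 0)%:E.
have fX u w : 0 <= u -> (Num.min (X u w i) C)%:E = f (X u w).
  by move=> u0; congr _%:E; apply/esym/max_idPl; exact: trunc_ge0.
have mf : measurable_fun setT f.
  apply/measurable_EFinP; apply: measurable_maxr => //.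
  by apply: measurable_minr => //; exact: measurable_coordinate.
have f0 y : (0 <= f y)%E by rewrite lee_fin le_max lexx orbT.
have [h1 h2] := markov_integral mf f0 Dx s0 t0.
have tE y : trunc_mean C t y i = (\int[Pr y]_w' f (X t w'))%E.
  by apply: eq_integral => w _; rewrite fX.
split; first by under eq_fun do rewrite tE.
rewrite /trunc_mean; under eq_integral do rewrite fX ?addr_ge0//.
by rewrite h2; apply: eq_integral => w _; rewrite -tE.
Qed.

(** The step size does not depend on y; this allows the estimate to be integrated over the law of
    [X s]. *)
Lemma generator_limit C i e : 0 <= C -> 0 < e -> exists2 d0, 0 < d0 &
  forall h y, 0 < h < d0 -> D y ->
  `|fine (trunc_mean C h y i) - Num.min (y i) C
    - h * generator p lam nu (fun y : config R S => Num.min (y i) C) y| <= e * h.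
Proof.
move=> C0 e0; case: X_model => _ /(_ _ (test_function_trunc i C0)) gen.
pose E := [set xy : R * R | ball xy.1 e xy.2].
have entE : entourage E by exact: (entourage_ball R (PosNum e0)).
pose f := fun y : config R S => Num.min (y i) C.
have : nbhs (generator p lam nu f : {uniform` D -> R})
    [set h | forall y, D y -> E (generator p lam nu f y, h y)].
  by apply/uniform_nbhs; exists E; split.
move=> /gen genE.
have /nbhs_ballP[d0 /= d00 H] : nbhs (0 : R) [set h | 0 < h -> forall y, D y ->
    E (generator p lam nu f y, h^-1 * (\int[Pr y]_w f (X h w) - f y))].
  exact: genE.
exists d0 => // h y /andP[h0 hd0] Dy.
have := H h; rewrite /ball /= sub0r normrN gtr0_norm// => /(_ hd0 h0 _ Dy).
rewrite /E /= => Hh.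
have h00 : h != 0 by rewrite gt_eqF.
rewrite (_ : _ - _ - _ = - (h * (generator p lam nu f y -
   h^-1 * (fine (trunc_mean C h y i) - Num.min (y i) C)))); last first.
  by rewrite -/f; field.
by rewrite normrN normrM gtr0_norm// mulrC ler_pM2r// ltW.
Qed.

(** Restart the process at [X s] by the Markov property, apply [generator_limit] and
    [generator_trunc_ge] there, and integrate. The step size is independent of s and x because
    [generator_limit] is uniform in the state. *)
Lemma trunc_mean_step_ge C i e : 0 <= C -> 0 < e -> exists2 d0 : R, 0 < d0 &
  forall s h x, 0 <= s -> 0 < h < d0 -> D x ->
  fine (trunc_mean C s x i)
    + h * (2 * fine (kapply K (trunc_mean (C / 2) s x) i)
           - 2 * fine (trunc_mean C s x i)) - e * h
  <= fine (trunc_mean C (s + h) x i).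
Proof.
move=> C0 e0; have [d0 d00 H] := generator_limit i C0 e0.
have C20 : 0 <= C / 2 by lra.
exists d0 => // s h x s0 hd Dx.
have h0 : 0 < h by case/andP: hd.
have K0 i' j' : 0 <= K i' j' by exact: lazy_kernel_ge0.
have Dw w : D (X s w) by move=> j; exact: process_ge0.
pose tr (w : Om) (j : S) := (Num.min (X s w j) (C / 2))%:E.
have tr0 w j : (0 <= tr w j)%E by rewrite lee_fin trunc_ge0.
have pointwise w : ((Num.min (X s w i) C)%:E + (2 * h)%:E * kapply K (tr w) i <=
    trunc_mean C h (X s w) i + ((2 * h)%:E * (Num.min (X s w i) C)%:E
    + (e * h)%:E))%E.
  have := H h (X s w) hd (Dw w) => /ler_normlP[H1 _].
  have H2 := generator_trunc_ge p_rw lam01 nu_redistribution nu_mean i (Dw w) C0.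
  have fT : trunc_mean C h (X s w) i \is a fin_num by rewrite trunc_mean_fin_num// ltW.
  rewrite [(2 * h)%R]mulrC EFinM -muleA.
  apply: (@le_trans _ _ ((Num.min (X s w i) C)%:E + h%:E *
     ((generator p lam nu (fun y => Num.min (y i) C) (X s w))%:E +
     (2 * Num.min (X s w i) C)%:E))%E).
    by rewrite leeD2l// lee_wpmul2l// lee_fin ltW.
  rewrite -(fineK fT); do 5 rewrite -?EFinD -?EFinM.
  rewrite lee_fin; lra.
have [mT TE] := trunc_mean_markov i C0 Dx s0 (ltW h0).
have mm := @measurable_trunc_process C s i s0.
have mK : measurable_fun [set: Om] (fun w => kapply K (tr w) i).
  apply: (@measurable_iter_kapply _ _ _ K0 _ _ _ tr 1) => // j.
  exact: measurable_trunc_process.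
have intK : (\int[Pr x]_w kapply K (tr w) i = kapply K (trunc_mean (C / 2) s x) i)%E.
  apply: (@integral_iter_kapply _ _ _ K0 _ _ _ _ tr 1) => // j.
  exact: measurable_trunc_process.
have mm0 w : (0 <= (Num.min (X s w i) C)%:E)%E by rewrite lee_fin trunc_ge0.
have h20 : 0 <= 2 * h by rewrite mulr_ge0// ltW.
have eh0 : 0 <= e * h by rewrite mulr_ge0// ltW.
have kap0 w : (0 <= kapply K (tr w) i)%E by exact: kapply_ge0.
have T0 w : (0 <= trunc_mean C h (X s w) i)%E by rewrite trunc_mean_ge0// ltW.
have := probability_integral_affine_le (Pr x) h20 eh0 mm mK mT mm mm0 kap0 T0 mm0 pointwise.
rewrite intK -TE.
rewrite -/(trunc_mean C s x i).
(* The rows of K sum to 1, so K preserves the bound C / 2. *)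
have kfin : kapply K (trunc_mean (C / 2) s x) i \is a fin_num.
  rewrite ge0_fin_numE; last by apply: kapply_ge0 => // j; exact: trunc_mean_ge0.
  apply: (@le_lt_trans _ _ (C / 2)%:E); last exact: ltry.
  apply: (iter_kapply_le K0 (lazy_kernel_sum1 p_rw lam01) 1) => // j.
  exact: trunc_mean_le.
rewrite -(fineK kfin) -(fineK (trunc_mean_fin_num x i C0 s0)).
rewrite -(fineK (trunc_mean_fin_num x i C0 (addr_ge0 s0 (ltW h0)))).
rewrite -!EFinM -!EFinD lee_fin /=.
lra.
Qed.

Lemma trunc_mean_step_le C r i e : 0 <= C -> 1 <= r * ((1 - lam) / 2) -> 0 < e ->
  exists2 d0 : R, 0 < d0 &
  forall s h x, 0 <= s -> 0 < h < d0 -> D x ->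
  fine (trunc_mean C (s + h) x i) <=
  fine (trunc_mean C s x i)
    + h * (2 * fine (kapply K (trunc_mean (r * C) s x) i)
           - 2 * fine (trunc_mean C s x i)) + e * h.
Proof.
move=> C0 rb e0; have [d0 d00 H] := generator_limit i C0 e0.
have C20 : 0 <= r * C by have [l0 l1] := andP lam01; rewrite mulr_ge0//; nra.
exists d0 => // s h x s0 hd Dx.
have h0 : 0 < h by case/andP: hd.
have K0 i' j' : 0 <= K i' j' by exact: lazy_kernel_ge0.
have Dw w : D (X s w) by move=> j; exact: process_ge0.
pose tr (w : Om) (j : S) := (Num.min (X s w j) (r * C))%:E.
have tr0 w j : (0 <= tr w j)%E by rewrite lee_fin trunc_ge0.
have pointwise w : (trunc_mean C h (X s w) i + (2 * h)%:E * (Num.min (X s w i) C)%:E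
    <= (Num.min (X s w i) C)%:E + ((2 * h)%:E * kapply K (tr w) i + (e * h)%:E))%E.
  have := H h (X s w) hd (Dw w) => /ler_normlP[_ H1].
  have H2 := generator_trunc_le p_rw lam01 nu_redistribution nu_mean i (Dw w) C0 rb.
  have fT : trunc_mean C h (X s w) i \is a fin_num by rewrite trunc_mean_fin_num// ltW.
  rewrite [(2 * h)%R]mulrC 2!EFinM -!muleA.
  apply: (@le_trans _ _ ((Num.min (X s w i) C)%:E + (h%:E *
     ((generator p lam nu (fun y => Num.min (y i) C) (X s w))%:E +
     (2 * Num.min (X s w i) C)%:E) + e%:E * h%:E))%E); last first.
    by rewrite leeD2l// leeD2r// lee_wpmul2l// lee_fin ltW.
  rewrite -(fineK fT); do 5 rewrite -?EFinD -?EFinM.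
  rewrite lee_fin; lra.
have [mT TE] := trunc_mean_markov i C0 Dx s0 (ltW h0).
have mm := @measurable_trunc_process C s i s0.
have mK : measurable_fun [set: Om] (fun w => kapply K (tr w) i).
  apply: (@measurable_iter_kapply _ _ _ K0 _ _ _ tr 1) => // j.
  exact: measurable_trunc_process.
have intK : (\int[Pr x]_w kapply K (tr w) i = kapply K (trunc_mean (r * C) s x) i)%E.
  apply: (@integral_iter_kapply _ _ _ K0 _ _ _ _ tr 1) => // j.
  exact: measurable_trunc_process.
have mm0 w : (0 <= (Num.min (X s w i) C)%:E)%E by rewrite lee_fin trunc_ge0.
have h20 : 0 <= 2 * h by rewrite mulr_ge0// ltW.
have eh0 : 0 <= e * h by rewrite mulr_ge0// ltW.
have kap0 w : (0 <= kapply K (tr w) i)%E by exact: kapply_ge0.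
have T0 w : (0 <= trunc_mean C h (X s w) i)%E by rewrite trunc_mean_ge0// ltW.
have := probability_integral_affine_le (Pr x) h20 eh0 mT mm mm mK T0 mm0 mm0 kap0 pointwise.
rewrite intK -TE.
rewrite -/(trunc_mean C s x i).
have kfin : kapply K (trunc_mean (r * C) s x) i \is a fin_num.
  rewrite ge0_fin_numE; last by apply: kapply_ge0 => // j; exact: trunc_mean_ge0.
  apply: (@le_lt_trans _ _ (r * C)%:E); last exact: ltry.
  apply: (iter_kapply_le K0 (lazy_kernel_sum1 p_rw lam01) 1) => // j.
  exact: trunc_mean_le.
rewrite -(fineK kfin) -(fineK (trunc_mean_fin_num x i C0 s0)).
rewrite -(fineK (trunc_mean_fin_num x i C0 (addr_ge0 s0 (ltW h0)))).
rewrite -!EFinM -!EFinD lee_fin /=.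
lra.
Qed.

End truncated_mean.

(** * Poisson bounds on truncated means and the mean formula *)

Section poisson_sums.
Variable R : realType.

(** Differentiating shifts the weights, and reindexing moves the shift to the coefficients:
    replacing [c m] by [c m.+1] is one more application of K. *)
Lemma is_derive_poisson_sum (a : R) (c : nat -> R) n (t : R) :
  is_derive t 1 (fun t => \sum_(m < n.+1) poisson_weight a m t * c m)
    (a * \sum_(m < n) poisson_weight a m t * c m.+1
     - a * \sum_(m < n.+1) poisson_weight a m t * c m).
Proof.
have dterm m : is_derive t 1 (fun t => poisson_weight a m t * c m)
    (c m * (a * ((if m is m'.+1 then poisson_weight a m' t else 0)
          - poisson_weight a m t))).
  rewrite (_ : (fun t => _) = c m \*: poisson_weight a m); last first.
    by apply/funext => s; rewrite /= mulrC.
  by apply: is_deriveZ; exact: is_derive_poisson_weight.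
elim: n => [|n IH].
  rewrite (_ : (fun t => _) = (fun t => poisson_weight a 0 t * c 0%N)); last first.
    by apply/funext => s; rewrite big_ord1.
  by apply: (is_derive_eq (dterm 0%N)); rewrite big_ord0 big_ord1; ring.
rewrite (_ : (fun t => _) =
   (fun t => \sum_(m < n.+1) poisson_weight a m t * c m) +
   (fun t => poisson_weight a n.+1 t * c n.+1)); last first.
  by apply/funext => s; rewrite big_ord_recr.
apply: (is_derive_eq (is_deriveD IH (dterm n.+1))).
rewrite big_ord_recr [in RHS]big_ord_recr /= [in RHS]big_ord_recr /=.
by rewrite big_ord_recr /=; ring.
Qed.

Lemma is_derive_exp_coeff (a : R) n (t : R) :
  is_derive t 1 (fun t => (a * t) ^+ n.+1 / n.+1`!%:R)
    (a * ((a * t) ^+ n / n`!%:R)).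
Proof.
have dlin : is_derive t 1 ( *%R a) a.
  by rewrite -[X in is_derive _ _ _ X]mulr1; exact: is_deriveZ.
have dpow := is_deriveZ (n.+1`!%:R^-1) (is_deriveX n.+1 dlin).
rewrite (_ : (fun t => _) = n.+1`!%:R^-1 \*: (( *%R a) ^+ n.+1)); last first.
  by apply/funext => r; rewrite !fctE mulrC.
apply: (is_derive_eq dpow); rewrite factS natrM /GRing.scale /=.
have m0 : n.+1%:R != 0 :> R by rewrite pnatr_eq0.
have f0 : n`!%:R != 0 :> R by rewrite pnatr_eq0 -lt0n fact_gt0.
move: (n.+1%:R : R) (n`!%:R : R) m0 f0 => M F M0 F0.
by field; rewrite M0 F0.
Qed.

End poisson_sums.

Section mean_formula.
Variables (R : realType) (S : countType) (p : S -> S -> R) (lam : R)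
    (nu : probability (measurableTypeR R) R).
Hypotheses (p_rw : symmetric_rw p) (lam01 : 0 < lam < 1)
    (nu_redistribution : redistribution_measure nu)
    (nu_mean : 'E_nu[fun e : R => e]%E = (2^-1)%:E).
Variables (d : measure_display) (Om : measurableType d)
    (Pr : config R S -> probability Om R) (X : R -> Om -> config R S).
Hypothesis X_model : wealth_model p lam nu Pr X.

Let D : set (config R S) := @nonneg_config R S.
Let K := lazy_kernel lam p.
Let K0 i j : 0 <= K i j := lazy_kernel_ge0 p_rw lam01 i j.
Let K1 i : (\esum_(j in [set: S]) (K i j)%:E = 1)%E := lazy_kernel_sum1 p_rw lam01 i.

Let trunc (C : R) (x : config R S) (j : S) : \bar R := (Num.min (x j) C)%:E.

Let moment C m (x : config R S) i : R := fine (iter m (kapply K) (trunc C x) i).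

Let trunc_ge0 C x j : 0 <= C -> D x -> (0 <= trunc C x j)%E.
Proof. by move=> C0 Dx; rewrite lee_fin le_min C0 Dx. Qed.

Let momentE C m x i : 0 <= C -> D x ->
  (moment C m x i)%:E = iter m (kapply K) (trunc C x) i.
Proof.
move=> C0 Dx; rewrite fineK// ge0_fin_numE; last first.
  by apply: iter_kapply_ge0 => // j; exact: trunc_ge0.
apply: (@le_lt_trans _ _ C%:E); last exact: ltry.
by apply: iter_kapply_le => // j; rewrite lee_fin ge_min lexx orbT.
Qed.

Let M C t x i : R := fine (trunc_mean Pr X C t x i).

Let ME C t x i : 0 <= C -> 0 <= t -> (M C t x i)%:E = trunc_mean Pr X C t x i.
Proof. by move=> C0 t0; rewrite fineK// (trunc_mean_fin_num X_model). Qed.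

Let M_ge0 C t x i : 0 <= C -> 0 <= t -> 0 <= M C t x i.
Proof. by move=> C0 t0; rewrite -lee_fin ME// (trunc_mean_ge0 X_model). Qed.

Let M_le C t x i : 0 <= C -> 0 <= t -> M C t x i <= C.
Proof. by move=> C0 t0; rewrite -lee_fin ME// (trunc_mean_le X_model). Qed.

Let M0 C x i : 0 <= C -> D x -> M C 0 x i = Num.min (x i) C.
Proof. by move=> C0 Dx; rewrite /M (trunc_mean0 X_model). Qed.

Let kM C t x i : R := fine (kapply K (trunc_mean Pr X C t x) i).

Let kME C t x i : 0 <= C -> 0 <= t ->
  (kM C t x i)%:E = kapply K (trunc_mean Pr X C t x) i.
Proof.
move=> C0 t0; rewrite fineK// ge0_fin_numE; last first.
  by apply: kapply_ge0 => // j; exact: (trunc_mean_ge0 X_model).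
apply: (@le_lt_trans _ _ C%:E); last exact: ltry.
by apply: (iter_kapply_le K0 K1 1) => // j; exact: (trunc_mean_le X_model).
Qed.

Let kM_ge0 C t x i : 0 <= C -> 0 <= t -> 0 <= kM C t x i.
Proof.
move=> C0 t0; rewrite -lee_fin kME//.
by apply: kapply_ge0 => // j; exact: (trunc_mean_ge0 X_model).
Qed.

Let kM_le C t x i : 0 <= C -> 0 <= t -> kM C t x i <= C.
Proof.
move=> C0 t0; rewrite -lee_fin kME//.
by apply: (iter_kapply_le K0 K1 1) => // j; exact: (trunc_mean_le X_model).
Qed.

Let r : R := 2 / (1 - lam).

Let r0 : 0 < r.
Proof. by have [l0 l1] := andP lam01; rewrite divr_gt0// subr_gt0. Qed.

Let rb : 1 <= r * ((1 - lam) / 2).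
Proof.
have [l0 l1] := andP lam01; have l2 : 1 - lam != 0 by rewrite gt_eqF// subr_gt0.
by rewrite (_ : r * _ = 1)// /r; field.
Qed.

(** Both one-step estimates at e = 1: the damping costs at most 2C, the gain is at most 2rC, and 1
    is the error. *)
Let M_lipschitz C x i : 0 <= C -> D x -> exists2 d0 : R, 0 < d0 &
  forall s h : R, 0 <= s -> 0 < h < d0 ->
  `|M C (s + h) x i - M C s x i| <= (2 * C + 2 * (r * C) + 1) * h.
Proof.
move=> C0 Dx.
have [d1 d10 H1] := trunc_mean_step_ge p_rw lam01 nu_redistribution nu_mean X_model i C0 ltr01.
have [d2 d20 H2] := trunc_mean_step_le p_rw lam01 nu_redistribution nu_mean X_model i C0 rb ltr01.
have C20 : 0 <= C / 2 by lra.
have rC0 : 0 <= r * C by rewrite mulr_ge0// ltW.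
exists (Num.min d1 d2); first by rewrite lt_min d10.
move=> s h s0; rewrite lt_min => /and3P[h0 hd1 hd2].
have := H1 s h x s0; rewrite h0 hd1 => /(_ isT Dx) L1.
have := H2 s h x s0; rewrite h0 hd2 => /(_ isT Dx) L2.
move: L1 L2; rewrite -/(M C s x i) -/(M C (s + h) x i) -/(kM _ s x i) -/(kM _ s x i).
have := M_ge0 x i C0 s0; have := M_le x i C0 s0.
have := kM_ge0 x i C20 s0; have := kM_le x i rC0 s0.
move: (M C s x i) (M C (s + h) x i) (kM (C / 2) s x i) (kM (r * C) s x i) => a b k1 k2.
move=> h1 h2 h3 h4 h5 h6; apply/ler_normlP; split; nra.
Qed.

(* The differential inequality for one truncation level involves the next one, so
   each step of the induction loses a factor 2; dually, each step of
   [trunc_mean_upper] gains a factor r, which the factorial in the remainder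
   absorbs. *)
Lemma trunc_mean_lower n C t x i : 0 <= C -> 0 <= t -> D x ->
  \sum_(m < n) poisson_weight 2 m t * moment C m x i <= M (2 ^+ n * C) t x i.
Proof.
elim: n C t i => [|n IH] C t i C0 t0 Dx.
  by rewrite big_ord0 M_ge0// mulr_ge0.
have C'0 : 0 <= 2 ^+ n.+1 * C by rewrite mulr_ge0// exprn_ge0.
have [d0 d00 lip] := M_lipschitz i C'0 Dx.
pose dv s := 2 * \sum_(m < n) poisson_weight 2 m s * moment C m.+1 x i
  - 2 * \sum_(m < n.+1) poisson_weight 2 m s * moment C m x i.
apply: (@damped_comparison R (fun s => M (2 ^+ n.+1 * C) s x i)
  (fun s => 2 * kM (2 ^+ n.+1 * C / 2) s x i)
  (fun s => \sum_(m < n.+1) poisson_weight 2 m s * moment C m x i) dv _ d0) => //.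
- exact: lip.
- move=> e e0.
  have [d1 d10 H1] := trunc_mean_step_ge p_rw lam01 nu_redistribution nu_mean X_model i C'0 e0.
  by exists d1 => // s h s0 hd; exact: H1.
- by move=> s s0; exact: (is_derive_poisson_sum 2 (fun m => moment C m x i) n s).
(* The damping cancels. What remains is the induction hypothesis at level 2^n C averaged by K, which
   sends the m-th moment to the next one. *)
- move=> s s0; rewrite /dv subrK ler_pM2l// -lee_fin.
  rewrite (_ : 2 ^+ n.+1 * C / 2 = 2 ^+ n * C); last by rewrite exprS; field.
  rewrite kME ?mulr_ge0 ?exprn_ge0//.
  have w0 m : 0 <= poisson_weight 2 m s by rewrite poisson_weight_ge0.
  apply: (@le_trans _ _ (kapply K (fun j =>
      (\sum_(m <- index_enum 'I_n) (poisson_weight 2 m s)%:E *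
        iter m (kapply K) (trunc C x) j)%E) i)); last first.
    apply: le_kapply => // j; rewrite -ME ?mulr_ge0 ?exprn_ge0//.
    rewrite (eq_bigr (fun m : 'I_n => (poisson_weight 2 m s * moment C m x j)%:E)).
      by rewrite sumEFin lee_fin; exact: IH.
    by move=> m _; rewrite [RHS]EFinM momentE.
  rewrite kapply_sum// => [|m j]; last first.
    by rewrite mule_ge0 ?lee_fin// iter_kapply_ge0// => j'; exact: trunc_ge0.
  rewrite -sumEFin; apply: lee_sum => m _.
  rewrite kapplyZ// => [|j]; last first.
    by apply: iter_kapply_ge0 => // j'; exact: trunc_ge0.
  by rewrite [leLHS]EFinM momentE.
- rewrite M0// big_ord_recl big1 => [|m _]; last first.
    by rewrite poisson_weight_at0 mul0r.
  rewrite poisson_weight_at0 mul1r addr0 /moment /= le_min ge_min lexx /=.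
  rewrite ge_min; apply/orP; right.
  by rewrite ler_peMl// exprn_ege1//; lra.
Qed.

Lemma trunc_mean_upper n C t x i : 0 <= C -> 0 <= t -> D x ->
  M C t x i <= \sum_(m < n) poisson_weight 2 m t * moment (r ^+ m * C) m x i
    + (2 * t) ^+ n / n`!%:R * (r ^+ n * C).
Proof.
elim: n C t i => [|n IH] C t i C0 t0 Dx.
  by rewrite big_ord0 add0r !expr0 fact0 divr1 !mul1r M_le.
have rC0 : 0 <= r * C by rewrite mulr_ge0// ltW.
have [d0 d00 lip] := M_lipschitz i C0 Dx.
pose c m := moment (r ^+ m * C) m x i.
pose A := r ^+ n.+1 * C.
have A0 : 0 <= A by rewrite mulr_ge0// exprn_ge0// ltW.
pose v s := \sum_(m < n.+1) poisson_weight 2 m s * c m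
  + (2 * s) ^+ n.+1 / n.+1`!%:R * A.
pose dv s := (2 * \sum_(m < n) poisson_weight 2 m s * c m.+1
  - 2 * \sum_(m < n.+1) poisson_weight 2 m s * c m)
  + A * (2 * ((2 * s) ^+ n / n`!%:R)).
apply: (@damped_comparison_le R (fun s => M C s x i)
  (fun s => 2 * kM (r * C) s x i) v dv _ d0) => //.
- exact: lip.
- move=> e e0.
  have [d1 d10 H1] := trunc_mean_step_le p_rw lam01 nu_redistribution nu_mean X_model i C0 rb e0.
  by exists d1 => // s h s0 hd; exact: H1.
- move=> s s0; apply: is_deriveD; first exact: (is_derive_poisson_sum 2 c n s).
  rewrite (_ : (fun s => _) = A \*: (fun s : R => (2 * s) ^+ n.+1 / n.+1`!%:R)).
    by apply: is_deriveZ; exact: is_derive_exp_coeff.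
  by apply/funext => z; rewrite /= mulrC.
- move=> s s0.
  have w0 m : 0 <= poisson_weight 2 m s by rewrite poisson_weight_ge0.
  have rem0 m : 0 <= (2 * s) ^+ m / m`!%:R.
    by rewrite divr_ge0// exprn_ge0// mulr_ge0.
  have rmC0 m : 0 <= r ^+ m * (r * C) by rewrite mulr_ge0// exprn_ge0// ltW.
  (* In dv + 2v the damping of the Poisson sum cancels and the remainder differentiates to twice its
     predecessor; the term 2 times the new remainder is nonnegative and is dropped. *)
  suff : kM (r * C) s x i <= \sum_(m < n) poisson_weight 2 m s * c m.+1
      + (2 * s) ^+ n / n`!%:R * A.
    rewrite /dv /v; have := mulr_ge0 (rem0 n.+1) A0; lra.
  rewrite -lee_fin kME//.
  apply: (@le_trans _ _ (kapply K (fun j =>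
      (\sum_(m <- index_enum 'I_n) (poisson_weight 2 m s)%:E *
        iter m (kapply K) (trunc (r ^+ m * (r * C)) x) j +
      ((2 * s) ^+ n / n`!%:R * A)%:E)%E) i)).
    apply: le_kapply => // j; rewrite -ME//.
    rewrite (eq_bigr (fun m : 'I_n =>
        (poisson_weight 2 m s * moment (r ^+ m * (r * C)) m x j)%:E)).
      rewrite sumEFin -EFinD lee_fin (_ : A = r ^+ n * (r * C)); first exact: IH.
      by rewrite /A exprSr mulrA.
    by move=> m _; rewrite [RHS]EFinM momentE.
  have tr0 m j : (0 <= trunc (r ^+ m * (r * C)) x j)%E.
    exact: trunc_ge0.
  have t0' m j : (0 <= (poisson_weight 2 m s)%:E *
      iter m (kapply K) (trunc (r ^+ m * (r * C)) x) j)%E.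
    by rewrite mule_ge0 ?lee_fin// iter_kapply_ge0.
  have r'0 : (0 <= (2 * s) ^+ n / n`!%:R * A) by rewrite mulr_ge0.
  rewrite kapplyD// => [|j]; last exact: sume_ge0.
  rewrite (kapply_cst K0 K1)// kapply_sum//.
  rewrite EFinD leeD2r// -sumEFin; apply: lee_sum => m _.
  rewrite kapplyZ// => [|j]; last exact: iter_kapply_ge0.
  by rewrite [leRHS]EFinM /c exprSr -mulrA momentE.
- rewrite M0// /v big_ord_recl big1 => [|m _]; last first.
    by rewrite poisson_weight_at0 mul0r.
  by rewrite poisson_weight_at0 mul1r addr0 mulr0 expr0n !mul0r addr0 /c /moment /= expr0 mul1r.
Qed.

Let trunc_nat_homo (y : R) :
  {homo (fun k : nat => (Num.min y k%:R)%:E) : l m / (l <= m)%N >-> (l <= m)%E}.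
Proof.
move=> l m lm; rewrite lee_fin le_min !ge_min lexx /=.
by apply/orP; right; rewrite ler_nat.
Qed.

Let trunc_nat_cvg (y : R) : ((Num.min y k%:R)%:E @[k --> \oo] --> y%:E)%E.
Proof.
apply: cvg_near_cst; near=> k; congr _%:E; apply/min_idPl.
by near: k; exact: nbhs_infty_ger.
Unshelve. all: by end_near. Qed.

Lemma mean_formula t x i : 0 <= t -> D x ->
  (\int[Pr x]_w (X t w i)%:E = \esum_(m in [set: nat])
    ((poisson_weight 2 m t)%:E *
     iter m (kapply K) (fun j => (x j)%:E) i))%E.
Proof.
move=> t0 Dx; apply/eqP; rewrite eq_le; apply/andP.
have w0 m : 0 <= poisson_weight 2 m t by rewrite poisson_weight_ge0.
have x0 j : (0 <= (x j)%:E)%E by rewrite lee_fin Dx.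
have it0 m j : (0 <= iter m (kapply K) (fun j => (x j)%:E) j)%E.
  exact: iter_kapply_ge0.
have a0 m : (0 <= (poisson_weight 2 m t)%:E *
    iter m (kapply K) (fun j => (x j)%:E) i)%E by rewrite mule_ge0 ?lee_fin.
have mX := measurable_process_coordinate X_model i t0.
have X0 w : 0 <= X t w i by exact: (process_ge0 X_model).
split.
(* Upper bound: at a fixed level k the moments lie below the untruncated ones and the remainder, an
   exponential coefficient times k, vanishes as n grows. Only then does k tend to infinity. *)
- have cvgE : (trunc_mean Pr X k%:R t x i @[k --> \oo] -->
      \int[Pr x]_w (X t w i)%:E)%E.
    rewrite [X in _ --> X](_ : _ =
        \int[Pr x]_w limn (fun k => (Num.min (X t w i) k%:R)%:E))%E.
      apply: cvg_monotone_convergence => //.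
      + by move=> k; exact: (measurable_trunc_process X_model).
      + by move=> k w _; rewrite lee_fin le_min X0 ler0n.
    by apply: eq_integral => w _; apply/esym/cvg_lim => //; exact: trunc_nat_cvg.
  rewrite -(cvg_lim _ cvgE)//; apply: lime_le; first exact: cvgP cvgE.
  apply: nearW => k.
  set L := esum _ _.
  suff le_n n : (trunc_mean Pr X k%:R t x i <=
      L + ((2 * t * r) ^+ n / n`!%:R * k%:R)%:E)%E.
    apply/lee_addgt0Pr => e e0.
    have /cvgrPdist_le/(_ e e0)[n _ /(_ n (leqnn n))] :
        (fun n => exp_coeff (2 * t * r) n * k%:R) @ \oo --> (0 : R).
      by rewrite -(mul0r k%:R); apply: cvgMl; exact: cvg_exp_coeff.
    rewrite /= sub0r normrN => /ler_normlP[_ en].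
    by rewrite (le_trans (le_n n))// leeD2l.
  rewrite -ME// (@le_trans _ _
    (\sum_(m < n) poisson_weight 2 m t * moment (r ^+ m * k%:R) m x i
    + (2 * t) ^+ n / n`!%:R * (r ^+ n * k%:R))%:E)//.
    by rewrite lee_fin; exact: trunc_mean_upper.
  rewrite EFinD; apply: leeD; last first.
    rewrite lee_fin [leRHS](_ : _ = (2 * t) ^+ n / n`!%:R * (r ^+ n * k%:R))//.
    by rewrite [(2 * t * r) ^+ n]exprMn; ring.
  rewrite -sumEFin /L -nneseries_esumT//.
  apply: (@le_trans _ _ (\sum_(0 <= m < n) ((poisson_weight 2 m t)%:E *
    iter m (kapply K) (fun j => (x j)%:E) i))%E); last exact: nneseries_lim_ge.
  rewrite big_mkord; apply: lee_sum => m _.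
  rewrite EFinM lee_wpmul2l ?lee_fin// momentE//; last first.
    by rewrite mulr_ge0// exprn_ge0// ltW.
  by apply: le_iter_kapply => // j; rewrite lee_fin ge_min lexx.
(* Lower bound: every partial sum at level k is at most a truncated mean at level 2^n k, hence at
   most the full mean, so the growth of the level is harmless. *)
- pose a k m := ((poisson_weight 2 m t)%:E * iter m (kapply K) (trunc k%:R x) i)%E.
  have tr0 k j : (0 <= trunc k%:R x j)%E by exact: trunc_ge0.
  have ak0 k m : (0 <= a k m)%E by rewrite mule_ge0 ?lee_fin ?iter_kapply_ge0.
  have cvgE : (\esum_(m in [set: nat]) a k m @[k --> \oo] -->
      \esum_(m in [set: nat]) ((poisson_weight 2 m t)%:E *
        iter m (kapply K) (fun j => (x j)%:E) i))%E.
    apply: esum_cvg => //.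
    + move=> m k l kl; rewrite lee_wpmul2l ?lee_fin//.
      by apply: le_iter_kapply => // j; exact: trunc_nat_homo.
    + move=> m; apply: cvgeZl => //; apply: iter_kapply_cvg => // j.
        by move=> k l kl; exact: trunc_nat_homo.
      exact: trunc_nat_cvg.
  rewrite -(cvg_lim _ cvgE)//; apply: lime_le; first exact: cvgP cvgE.
  apply: nearW => k; rewrite -nneseries_esumT//.
  apply: lime_le; first exact: is_cvg_nneseries.
  apply: nearW => n; rewrite big_mkord.
  apply: (@le_trans _ _ (trunc_mean Pr X (2 ^+ n * k%:R) t x i)).
    rewrite -ME ?mulr_ge0 ?exprn_ge0//.
    rewrite (eq_bigr (fun m : 'I_n => (poisson_weight 2 m t * moment k%:R m x i)%:E)).
      by rewrite sumEFin lee_fin; exact: trunc_mean_lower.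
    by move=> m _; rewrite [RHS]EFinM momentE.
  apply: ge0_le_integral => //.
  + by move=> w _; rewrite lee_fin le_min X0 mulr_ge0// exprn_ge0.
  + exact: (measurable_trunc_process X_model).
  + exact/measurable_EFinP.
  + by move=> w _; rewrite lee_fin ge_min lexx.
Qed.

End mean_formula.

(** * The law of the walk *)

Section poisson_mixtures.
Local Open Scope ereal_scope.
Variables (R : realType).

Lemma esum_natS (f : nat -> \bar R) : (forall n, 0 <= f n) ->
  \esum_(n in [set: nat]) f n = f 0%N + \esum_(n in [set: nat]) f n.+1.
Proof.
move=> f0; rewrite -!nneseries_esumT// nneseries_recl//.
congr (_ + _); rewrite -(nneseries_addn 1)//.
by apply: eq_eseriesr => n _; rewrite addn1.
Qed.

Lemma esum_nat_addn (f : nat -> \bar R) l : (forall n, 0 <= f n) ->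
  (forall n, (n < l)%N -> f n = 0) ->
  \esum_(n in [set: nat]) f n = \esum_(n in [set: nat]) f (n + l)%N.
Proof.
move=> f0; elim: l => [|l IH] fl.
  by apply: eq_esum => n _; rewrite addn0.
rewrite IH => [|n nl]; last by apply: fl; exact: ltnW.
rewrite esum_natS// add0n fl// add0e.
by apply: eq_esum => n _; rewrite addSnnS.
Qed.

Lemma esum_exp_coeff (a : R) : (0 <= a)%R ->
  \esum_(n in [set: nat]) (a ^+ n / n`!%:R)%:E = (expR a)%:E.
Proof.
move=> a0; rewrite -nneseries_esumT; last first.
  by move=> n; rewrite lee_fin divr_ge0// exprn_ge0.
apply/cvg_lim => //.
under eq_fun do rewrite sumEFin.
by apply: cvg_EFin; [exact: nearW|exact: is_cvg_series_exp_coeff].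
Qed.

Lemma esum_poisson_weight (c t : R) : (0 <= c)%R -> (0 <= t)%R ->
  \esum_(n in [set: nat]) (poisson_weight c n t)%:E = 1.
Proof.
move=> c0 t0; have ct0 : (0 <= c * t)%R by rewrite mulr_ge0.
under eq_esum do rewrite /poisson_weight -mulrA EFinM.
rewrite esumZl ?expR_ge0// => [|n]; last first.
  by rewrite lee_fin divr_ge0// exprn_ge0.
by rewrite esum_exp_coeff// -EFinM -expRD addNr expR0.
Qed.

(** For a + b = 1, the probability that exactly l of m lazy steps are steps of p. For l > m the
    coefficient 'C(m, l) is 0, whatever the truncated subtraction yields. *)
Let binom (a b : R) m l : R := 'C(m, l)%:R * a ^+ (m - l) * b ^+ l.

Let binom_ge0 (a b : R) m l : (0 <= a)%R -> (0 <= b)%R -> (0 <= binom a b m l)%R.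
Proof. by move=> a0 b0; rewrite /binom mulr_ge0 ?exprn_ge0// mulr_ge0 ?exprn_ge0. Qed.

Let binomS (a b : R) m l :
  binom a b m.+1 l.+1 = (a * binom a b m l.+1 + b * binom a b m l)%R.
Proof.
rewrite /binom subSS binS natrD exprS.
have [lm|ml] := ltnP l m.
  by rewrite -(subnSK lm) !exprS; ring.
by rewrite bin_small// mulr0n !mul0r add0r; ring.
Qed.

(** Poisson thinning: keeping each point with probability b turns rate c into c b. *)
Lemma esum_poisson_weight_binomial (c a b t : R) l :
  (0 <= c)%R -> (0 <= a)%R -> (0 <= b)%R -> (a + b = 1)%R -> (0 <= t)%R ->
  \esum_(m in [set: nat]) (poisson_weight c m t * binom a b m l)%:E =
  (poisson_weight (c * b) l t)%:E.
Proof.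
move=> c0 a0 b0 ab t0.
have ct0 : (0 <= c * t)%R by rewrite mulr_ge0.
have f0 m : 0 <= (poisson_weight c m t * binom a b m l)%:E.
  by rewrite lee_fin mulr_ge0 ?poisson_weight_ge0 ?binom_ge0.
rewrite (@esum_nat_addn _ l)// => [|m ml]; last first.
  by rewrite /binom bin_small// !mul0r mulr0.
transitivity (\esum_(n in [set: nat])
    ((expR (- (c * t)) * (c * b * t) ^+ l / l`!%:R)%:E *
     ((c * a * t) ^+ n / n`!%:R)%:E)).
  apply: eq_esum => n _; rewrite -EFinM; congr _%:E.
  rewrite /poisson_weight /binom addnK.
  have bf : ('C(n + l, l)%:R * (l`!%:R * n`!%:R) = (n + l)`!%:R :> R)%R.
    by rewrite -!natrM -(bin_fact (leq_addl n l)) addnK.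
  have B0 : ('C(n + l, l)%:R != 0 :> R)%R.
    by rewrite pnatr_eq0 -lt0n bin_gt0 leq_addl.
  have L0 : (l`!%:R != 0 :> R)%R by rewrite pnatr_eq0 -lt0n fact_gt0.
  have N0 : (n`!%:R != 0 :> R)%R by rewrite pnatr_eq0 -lt0n fact_gt0.
  rewrite -bf !exprMn exprD; move: B0 L0 N0.
  move: ('C(n + l, l)%:R : R) (l`!%:R : R) (n`!%:R : R) => B L N B0 L0 N0.
  by rewrite exprD; field; rewrite B0 L0 N0.
rewrite esumZl => [||n].
- rewrite esum_exp_coeff; last by rewrite !mulr_ge0.
  rewrite -EFinM; congr _%:E; rewrite /poisson_weight.
  have -> : expR (- (c * b * t)) = (expR (- (c * t)) * expR (c * a * t))%R.
    have -> : (a = 1 - b)%R by rewrite -ab addrK.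
    by rewrite -expRD; congr expR; ring.
  by ring.
- by rewrite !mulr_ge0 ?expR_ge0 ?invr_ge0 ?exprn_ge0// !mulr_ge0.
- by rewrite lee_fin divr_ge0// exprn_ge0// !mulr_ge0.
Qed.

Variables (S : countType) (p : S -> S -> R) (lam : R).
Hypotheses (p_rw : symmetric_rw p) (lam01 : (0 < lam < 1)%R).

Let a : R := (1 + lam) / 2.
Let b : R := (1 - lam) / 2.
Let a0 : (0 <= a)%R. Proof. by rewrite /a; case/andP: lam01 => *; lra. Qed.
Let b0 : (0 <= b)%R. Proof. by rewrite /b; case/andP: lam01 => *; lra. Qed.
Let p0 i j : (0 <= p i j)%R. Proof. by case: p_rw. Qed.

(** The binomial expansion of (a + b P)^m by Pascal's rule, as a sum over all l so that it can be
    exchanged with the Poisson sum. *)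
Lemma iter_kapply_lazy_kernel (h : S -> \bar R) m i : (forall j, 0 <= h j) ->
  iter m (kapply (lazy_kernel lam p)) h i =
  \esum_(l in [set: nat]) ((binom a b m l)%:E * iter l (kapply p) h i).
Proof.
move=> h0; have it0 l j : 0 <= iter l (kapply p) h j by exact: iter_kapply_ge0.
have bt0 n l j : 0 <= (binom a b n l)%:E * iter l (kapply p) h j.
  by rewrite mule_ge0// lee_fin binom_ge0.
elim: m i => [|m IH] i.
  rewrite esum_natS// esum1 ?adde0 => [|l _]; last first.
    by rewrite /binom bin0n !mul0r mul0e.
  by rewrite /binom bin0 subn0 !expr0 !mulr1 mul1e.
rewrite iterS (_ : iter m _ h = fun j => \esum_(l in [set: nat])
  ((binom a b m l)%:E * iter l (kapply p) h j)); last exact/funext.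
rewrite kapply_lazy_kernel// -/a -/b => [|j]; last exact: esum_ge0.
rewrite kapply_esum// [RHS]esum_natS// [X in _ * X + _]esum_natS//.
rewrite ge0_muleDr ?esum_ge0// -addeA; congr (_ + _).
  rewrite muleA -EFinM; congr (_%:E * _).
  by rewrite /binom !bin0 !subn0 !expr0 exprS; ring.
rewrite -!esumZl// => [|l]; last exact: kapply_ge0.
rewrite -esumD => [|l _|l _]; last 2 first.
- by rewrite mule_ge0.
- by rewrite mule_ge0// ?lee_fin// kapply_ge0.
apply: eq_esum => l _; rewrite kapplyZ ?binom_ge0//.
rewrite -[kapply p (iter l _ h) i]/(iter l.+1 (kapply p) h i) !muleA -!EFinM.
rewrite -ge0_muleDl; last 2 first.
- by rewrite lee_fin mulr_ge0// binom_ge0.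
- by rewrite lee_fin mulr_ge0// binom_ge0.
by rewrite -EFinD binomS.
Qed.

(** Discarding the lazy steps of a rate 2 clock leaves rate 2b = 1 - lam. Nonnegative series are
    rearranged, since the values may be infinite. *)
Lemma poisson_mixture_lazy_kernel (h : S -> \bar R) (t : R) i :
  (forall j, 0 <= h j) -> (0 <= t)%R ->
  \esum_(m in [set: nat])
    ((poisson_weight 2 m t)%:E * iter m (kapply (lazy_kernel lam p)) h i) =
  \esum_(l in [set: nat])
    ((poisson_weight (1 - lam) l t)%:E * iter l (kapply p) h i).
Proof.
move=> h0 t0; have it0 l j : 0 <= iter l (kapply p) h j by exact: iter_kapply_ge0.
have w0 m : (0 <= poisson_weight 2 m t)%R by rewrite poisson_weight_ge0.
have wb0 m l : 0 <= (poisson_weight 2 m t * binom a b m l)%:E.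
  by rewrite lee_fin mulr_ge0 ?binom_ge0.
transitivity (\esum_(m in [set: nat]) \esum_(l in [set: nat])
    ((poisson_weight 2 m t * binom a b m l)%:E * iter l (kapply p) h i)).
  apply: eq_esum => m _; rewrite iter_kapply_lazy_kernel// -esumZl//.
    by apply: eq_esum => l _; rewrite muleA -EFinM.
  by move=> l; rewrite mule_ge0// lee_fin binom_ge0.
rewrite esum_esum_comm => [|m l]; last by rewrite mule_ge0.
apply: eq_esum => l _.
have -> : (1 - lam = 2 * b)%R by rewrite /b; field.
rewrite -(@esum_poisson_weight_binomial 2 a b)//; last by rewrite /a /b; field.
by rewrite -esumMr.
Qed.

End poisson_mixtures.

Section countable_valued.
Local Open Scope ereal_scope.
Context d (T : measurableType d) (R : realType) (mu : probability T R).
Variables (S : countType) (Z : T -> S).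
Hypothesis mZ : forall j, measurable [set w | Z w = j].

Let measurable_delta j : measurable_fun [set: T] (fun w => (Z w == j)%:R%:E : \bar R).
Proof.
rewrite (_ : (fun w => _) = EFin \o \1_[set w | Z w = j]).
  by apply/measurable_EFinP; exact: measurable_indic.
apply/funext => w; rewrite /= indicE; congr ((nat_of_bool _)%:R%:E).
by apply/eqP/idP => [<-|]; rewrite inE.
Qed.

Let integral_delta (A : set T) j : measurable A ->
  \int[mu]_(w in A) ((Z w == j)%:R)%:E = mu (A `&` [set w | Z w = j]).
Proof.
move=> mA; rewrite setIC -integral_indic//; apply: eq_integral => w _.
by rewrite indicE; congr ((nat_of_bool _)%:R%:E); apply/eqP/idP => [<-|]; rewrite inE.
Qed.

Lemma measure_esum_values (A : set T) : measurable A ->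
  mu A = \esum_(j in [set: S]) mu (A `&` [set w | Z w = j]).
Proof.
move=> mA.
transitivity (\int[mu]_(w in A) \esum_(j in [set: S]) ((Z w == j)%:R)%:E).
  rewrite -[LHS]mul1e -integral_cst//; apply: eq_integral => w _.
  rewrite -(@esum_delta R S (Z w) (fun=> 1))//.
  by apply: eq_esum => j _; rewrite mule1 eq_sym.
rewrite integral_esum//.
  by apply: eq_esum => j _; exact: integral_delta.
by move=> j; exact: measurable_funTS.
Qed.

Lemma integral_countable_valued (f : S -> R) : (forall j, (0 <= f j)%R) ->
  \int[mu]_w (f (Z w))%:E =
  \esum_(j in [set: S]) (mu [set w | Z w = j] * (f j)%:E).
Proof.
move=> f0.
transitivity (\int[mu]_w \esum_(j in [set: S]) ((f j)%:E * ((Z w == j)%:R)%:E)).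
  apply: eq_integral => w _.
  rewrite -(@esum_delta R S (Z w) (fun j => (f j)%:E))//.
  by apply: eq_esum => j _; rewrite muleC eq_sym.
rewrite integral_esum//.
- apply: eq_esum => j _; rewrite ge0_integralZl ?lee_fin//.
  by rewrite integral_delta// setTI muleC.
- by move=> j; exact: measurable_funeM.
- by move=> j w _; rewrite mule_ge0// lee_fin.
Qed.

End countable_valued.

Section walk.
Local Open Scope ereal_scope.
Variables (R : realType) (S : countType) (p : S -> S -> R).
Hypothesis p_rw : symmetric_rw p.
Variables (d : measure_display) (Om : measurableType d)
  (Q : S -> probability Om R) (W : R -> Om -> S)
  (N : R -> Om -> nat) (Y : nat -> Om -> S).
Hypothesis WNY : walk_representation p Q W N Y.

Let p0 i j : (0 <= p i j)%R. Proof. by case: p_rw. Qed.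

Let prefix (s : R) m (y : nat -> S) l : set Om :=
  [set w | N s w = m /\ forall a, (a <= l)%N -> Y a w = y a].

Let mN s m : (0 <= s)%R -> measurable [set w | N s w = m].
Proof. by move=> s0; exact: (rw_measurable_clock WNY). Qed.

Let mYj n j : measurable [set w | Y n w = j].
Proof. exact: (rw_measurable_chain WNY). Qed.

Let mprefix s m y l : (0 <= s)%R -> measurable (prefix s m y l).
Proof.
move=> s0; rewrite (_ : prefix _ _ _ _ = [set w | N s w = m] `&`
    \bigcap_(a in [set a | (a <= l)%N]) [set w | Y a w = y a]).
  apply: measurableI; first exact: mN.
  exact: bigcap_measurableType.
by apply/seteqP; split=> w /= [].
Qed.

Let prefix_law i s m y : (0 <= s)%R ->
  Q i (prefix s m y m) = (poisson_weight 1 m s *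
    ((y 0%N == i)%:R * \prod_(l < m) p (y l) (y l.+1)))%:E.
Proof.
(* The single interval [0, s], extended constantly to a nondecreasing sequence. *)
move=> s0; pose tau l : R := if l is 0%N then 0%R else s.
have := rw_law WNY i 1 m (fun=> m) y (erefl : tau 0%N = 0%R).
rewrite big_ord1 /= subr0 /poisson_weight mul1r => <-.
  congr (Q i _); apply/seteqP; split=> w /= [h1 h2]; split=> //.
    by move=> [|//] _ /=; rewrite (rw_clock0 WNY) add0n.
  by have := h1 0%N isT; rewrite /= (rw_clock0 WNY) add0n.
by case=> [|a] [|b].
Qed.

(* Downward induction on the length l of the prescribed initial path. *)
Let path_law k l i s y j : (0 <= s)%R ->
  Q i (prefix s (l + k) y l `&` [set w | Y (l + k)%N w = j]) =
  (poisson_weight 1 (l + k) s *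
    ((y 0%N == i)%:R * \prod_(a < l) p (y a) (y a.+1)))%:E *
  iter k (kapply p) (fun a => (a == j)%:R%:E) (y l).
Proof.
move=> s0; elim: k l y => [|k IH] l y.
  rewrite addn0 /=; have [yj|yj] := eqVneq (y l) j.
    rewrite mule1 -prefix_law//; congr (Q i _); apply/setIidPl => w /= [_ h].
    by rewrite h.
  rewrite mule0 (_ : _ `&` _ = set0) ?measure0//.
  apply/seteqP; split=> // w /= [[_ h] Yj].
  by move/eqP: yj; apply; rewrite -h.
have mE : measurable (prefix s (l + k.+1) y l `&` [set w | Y (l + k.+1)%N w = j]).
  by apply: measurableI; [exact: mprefix|exact: mYj].
rewrite (measure_esum_values (Q i) (fun a => mYj l.+1 a) mE).
set c := (poisson_weight 1 (l + k.+1) s * ((y 0%N == i)%:R * \prod_(a < l) p (y a) (y a.+1)))%R.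
have c0 : (0 <= c)%R.
  apply: mulr_ge0; first exact: poisson_weight_ge0.
  by apply: mulr_ge0 => //; exact: prodr_ge0.
have it0 a : 0 <= iter k (kapply p) (fun a => (a == j)%:R%:E) a.
  by apply: iter_kapply_ge0 => // b; rewrite lee_fin.
transitivity (\esum_(a in [set: S]) (c%:E * ((p (y l) a)%:E *
    iter k (kapply p) (fun a => (a == j)%:R%:E) a))); last first.
  by rewrite esumZl// => a; rewrite mule_ge0// lee_fin.
apply: eq_esum => a _.
(* Prescribing the next position a lengthens the path by one step, whose factor p (y l) a is the
   summand of [kapply]. *)
pose y' n := if (n <= l)%N then y n else a.
have y'S : y' l.+1 = a by rewrite /y' ltnn.
have y'E n : (n <= l)%N -> y' n = y n by rewrite /y' => ->.
rewrite (_ : _ `&` _ = prefix s (l.+1 + k) y' l.+1 `&` [set w | Y (l.+1 + k)%N w = j]).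
  rewrite IH y'S muleA -EFinM; congr (_%:E * _).
  rewrite /c big_ord_recr /= y'S !y'E// addSnnS.
  rewrite (eq_bigr (fun b : 'I_l => p (y b) (y b.+1))); first by ring.
  by move=> b _; rewrite !y'E// ltnW.
rewrite addSnnS; apply/seteqP; split=> w /=.
  move=> [[[h1 h2] h3] h4]; split=> //; split=> // b.
  rewrite leq_eqVlt => /predU1P[->|]; first by rewrite y'S.
  by rewrite ltnS => bl; rewrite y'E// h2.
move=> [[h1 h2] h3]; split; last by rewrite (h2 l.+1 (leqnn _)).
by split=> //; split=> // b bl; rewrite h2 ?leqW// y'E.
Qed.

Lemma measurable_walk s j : (0 <= s)%R -> measurable [set w | W s w = j].
Proof.
move=> s0; rewrite (_ : [set w | _] =
    \bigcup_m ([set w | N s w = m] `&` [set w | Y m w = j])).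
  by apply: bigcup_measurable => m _; apply: measurableI => //; exact: mN.
apply/seteqP; split=> w /=; rewrite (rw_jumps WNY)//.
  by move=> h; exists (N s w).
by move=> [m _ /= [-> ->]].
Qed.

Lemma transition_probability_poisson s i j : (0 <= s)%R ->
  transition_probability Q W s i j =
  \esum_(m in [set: nat]) ((poisson_weight 1 m s)%:E *
    iter m (kapply p) (fun a => (a == j)%:R%:E) i).
Proof.
move=> s0; rewrite /transition_probability.
rewrite (measure_esum_values (Q i) (fun m => mN m s0) (measurable_walk j s0)).
apply: eq_esum => m _.
have mA : measurable ([set w | W s w = j] `&` [set w | N s w = m]).
  by apply: measurableI; [exact: measurable_walk|exact: mN].
have it0 a : 0 <= iter m (kapply p) (fun a => (a == j)%:R%:E) a.
  by apply: iter_kapply_ge0 => // b; rewrite /= lee_fin.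
(* [path_law] needs a prescribed starting point; under [Q i] its law charges a = i alone. *)
rewrite (measure_esum_values (Q i) (mYj 0) mA).
transitivity (\esum_(a in [set: S]) ((a == i)%:R%:E * ((poisson_weight 1 m s)%:E *
    iter m (kapply p) (fun a => (a == j)%:R%:E) a))).
  apply: eq_esum => a _.
  rewrite (_ : _ `&` _ = prefix s (0 + m) (fun=> a) 0 `&` [set w | Y (0 + m)%N w = j]).
    rewrite path_law// big_ord0 mulr1 add0n EFinM.
    by rewrite [_%:E * (_ == _)%:R%:E]muleC -muleA.
  rewrite add0n; apply/seteqP; split=> w /=; rewrite (rw_jumps WNY)//.
    by move=> [[h1 h2] h3]; rewrite h2 in h1; split=> //; split=> // b;
      rewrite leqn0 => /eqP ->.
  by move=> [[h1 h2] h3]; rewrite h1; split; [split|exact: h2].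
by rewrite esum_delta// => a; rewrite mule_ge0// lee_fin poisson_weight_ge0.
Qed.

Lemma esum_transition_probability s i (x : S -> R) : (0 <= s)%R ->
  (forall j, (0 <= x j)%R) ->
  \esum_(j in [set: S]) (transition_probability Q W s i j * (x j)%:E) =
  \esum_(m in [set: nat]) ((poisson_weight 1 m s)%:E *
    iter m (kapply p) (fun j => (x j)%:E) i).
Proof.
move=> s0 x0.
have w0 m : (0 <= poisson_weight 1 m s)%R by rewrite poisson_weight_ge0.
have delta0 a j : 0 <= (a == j)%:R%:E :> \bar R by rewrite lee_fin.
have it0 m j a : 0 <= iter m (kapply p) (fun a => (a == j)%:R%:E) a.
  exact: iter_kapply_ge0.
transitivity (\esum_(j in [set: S]) \esum_(m in [set: nat])
   (((poisson_weight 1 m s)%:E *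
    iter m (kapply p) (fun a => (a == j)%:R%:E) i) * (x j)%:E)).
  apply: eq_esum => j _; rewrite transition_probability_poisson// esumMr//.
    by rewrite lee_fin.
  by move=> m; rewrite mule_ge0// lee_fin.
rewrite esum_esum_comm => [|j m]; last by rewrite !mule_ge0// lee_fin.
apply: eq_esum => m _.
(* Expanding x in point masses reduces the claim to transition probabilities by linearity. *)
rewrite [in RHS](_ : (fun j => (x j)%:E) = fun a : S =>
    \esum_(j in [set: S]) ((x j)%:E * (a == j)%:R%:E)); last first.
  apply/funext => a; rewrite -[LHS](@esum_delta R S a (fun j => (x j)%:E)).
    by apply: eq_esum => j _; rewrite muleC eq_sym.
  by move=> j; rewrite lee_fin.
rewrite iter_kapply_esum// => [|j a]; last by rewrite mule_ge0// lee_fin.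
rewrite -esumZl// => [|j]; last first.
  by apply: iter_kapply_ge0 => // a; rewrite mule_ge0// lee_fin.
apply: eq_esum => j _; rewrite iter_kapplyZ//.
by rewrite -muleA; congr (_ * _); rewrite muleC.
Qed.

End walk.

(** * Invariant measures *)

Section stationary.
Local Open Scope ereal_scope.
Variables (R : realType) (S : countType) (k : S -> S -> R).
Hypothesis k_ge0 : forall i j, (0 <= k i j)%R.

Lemma poisson_stationary_harmonic (c : R) (h : S -> \bar R) :
  (0 < c)%R -> (forall i, 0 <= h i) -> (forall i, h i < +oo) ->
  (forall (t : R) i, (0 <= t)%R -> h i =
    \esum_(m in [set: nat]) ((poisson_weight c m t)%:E * iter m (kapply k) h i)) ->
  forall i, kapply k h i = h i.
Proof.
move=> c0 h0 hoo hE.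
have w0 m (t : R) : (0 <= t)%R -> (0 <= poisson_weight c m t)%R.
  by move=> t0; rewrite poisson_weight_ge0// ltW.
have it0 m i : 0 <= iter m (kapply k) h i by exact: iter_kapply_ge0.
have a0 m i (t : R) : (0 <= t)%R ->
    0 <= (poisson_weight c m t)%:E * iter m (kapply k) h i.
  by move=> t0; rewrite mule_ge0// lee_fin w0.
have hfin i : h i \is a fin_num by rewrite ge0_fin_numE.
have first_terms (t : R) i : (0 <= t)%R ->
    (expR (- (c * t)))%:E * h i +
    (expR (- (c * t)) * (c * t))%:E * kapply k h i <= h i.
  move=> t0; rewrite [leRHS](hE t)// esum_natS => [|m]; last exact: a0.
  rewrite esum_natS => [|m]; last exact: a0.
  rewrite /poisson_weight /= expr0 expr1 fact0 !divr1 mulr1 addeA leeDl//.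
  by apply: esum_ge0 => m _; exact: (a0 m.+2).
have kfin i : kapply k h i \is a fin_num.
  rewrite ge0_fin_numE; last exact: (it0 1%N).
  have ci0 : (0 <= (c^-1)%R)%R by rewrite invr_ge0 ltW.
  (* At time 1/c the coefficient of K h is e^(-1), which is positive, so an infinite K h would make
     h infinite. *)
  have := first_terms (c^-1)%R i ci0.
  rewrite mulfV ?gt_eqF// mulr1 => le1.
  have : (expR (- 1)%R)%:E * kapply k h i < +oo.
    apply: le_lt_trans (hoo i); apply: le_trans le1.
    by rewrite leeDr// mule_ge0// lee_fin expR_ge0.
  have : 0 <= kapply k h i by exact: (it0 1%N).
  case: (kapply k h i) => [r _ _|_|//]; first exact: ltry.
  by rewrite gt0_muley ?lte_fin ?expR_gt0.
have sub i : kapply k h i <= h i.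
  rewrite -(fineK (kfin i)) -(fineK (hfin i)) lee_fin.
  set u := fine (kapply k h i); set v := fine (h i).
  have u0 : (0 <= u)%R by rewrite fine_ge0// (it0 1%N).
  have v0 : (0 <= v)%R by rewrite fine_ge0.
  (* Here x = c t and E = e^(-x) >= 1 - x: from E v + x E u <= v follows x E u <= (1 - E) v <= x v,
     hence (1 - x) u <= E u <= v. *)
  have step (x : R) : (0 < x)%R -> ((1 - x) * u <= v)%R.
    move=> x0; have := first_terms (x / c)%R i (divr_ge0 (ltW x0) (ltW c0)).
    rewrite mulrCA mulfV ?gt_eqF// mulr1.
    rewrite -(fineK (kfin i)) -(fineK (hfin i)) -!EFinM -EFinD lee_fin -/u -/v.
    have := expR_ge1Dx (- x); have := expR_ge0 (- x).
    move: (expR (- x)) => E E0 E1 H.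
    have : (x * (E * u) <= x * v)%R by nra.
    by rewrite ler_pM2l// => H2; nra.
  rewrite leNgt; apply/negP => vu.
  have u1 : (0 < u + 1)%R by lra.
  (* Chosen so that x u <= (u - v)/2, which contradicts [step]. *)
  have x0 : (0 < (u - v) / 2 / (u + 1))%R by rewrite !divr_gt0//; lra.
  have := step _ x0.
  have : ((u - v) / 2 / (u + 1) * u <= (u - v) / 2)%R.
    by rewrite mulrAC ler_pdivrMr// ler_wpM2l//; lra.
  lra.
have iter_sub m i : iter m.+1 (kapply k) h i <= kapply k h i.
  elim: m i => [//|m IH] i.
  by apply: le_kapply => // j; exact: le_trans (IH j) (sub j).
move=> i; apply/eqP; rewrite eq_le sub /=.
have c00 : (0 <= c)%R by exact: ltW.
(* At time 1/c the weight w of m = 0 is below 1. The other weights sum to 1 - w and multiply terms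
   at most K h, so h <= w h + (1 - w) K h. *)
have := hE (c^-1)%R i; rewrite invr_ge0 => /(_ c00).
have ci0 : (0 <= (c^-1)%R)%R by rewrite invr_ge0.
rewrite esum_natS => [|m]; last exact: a0.
have := esum_poisson_weight c00 ci0.
rewrite esum_natS => [|m]; last by rewrite lee_fin w0.
set T := \esum_(n in [set: nat]) (poisson_weight c n.+1 (c^-1)%R)%:E => T1 hiE.
have T0 : 0 <= T by apply: esum_ge0 => m _; rewrite lee_fin w0.
have : h i <= (poisson_weight c 0 (c^-1)%R)%:E * h i + T * kapply k h i.
  rewrite {1}hiE leeD2l// /T -esumMr//; last 2 first.
  - exact: (it0 1%N).
  - by move=> m; rewrite lee_fin w0.
  by apply: le_esum => m _; rewrite lee_wpmul2l// lee_fin w0.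
have e1 : (poisson_weight c 0 (c^-1)%R < 1)%R.
  rewrite /poisson_weight expr0 fact0 divr1 mulr1 mulfV ?gt_eqF//.
have Tfin : T \is a fin_num.
  by move: T1; case: (T) T0 => //= [|]; rewrite ?addey.
rewrite -(fineK (kfin i)) -(fineK (hfin i)) -(fineK Tfin) -!EFinM -EFinD !lee_fin.
move: T1; rewrite -(fineK Tfin) -EFinD => -[].
move: (poisson_weight c 0 (c^-1)%R) (fine T) (fine (h i)) (fine (kapply k h i)) e1.
move=> w z u v w1 wz; have -> : z = (1 - w)%R by lra.
move=> /= H; have : ((1 - w) * u <= (1 - w) * v)%R by lra.
by rewrite ler_pM2l//; lra.
Qed.

End stationary.

Section invariance.
Local Open Scope ereal_scope.
Variables (R : realType) (S : countType) (p : S -> S -> R) (lam : R)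
    (nu : probability (measurableTypeR R) R).
Hypotheses (p_rw : symmetric_rw p) (lam01 : (0 < lam < 1)%R)
    (nu_redistribution : redistribution_measure nu)
    (nu_mean : 'E_nu[fun e : R => e]%E = (2^-1)%:E).
Variables (d : measure_display) (Om : measurableType d)
    (Pr : config R S -> probability Om R) (X : R -> Om -> config R S).
Hypothesis X_model : wealth_model p lam nu Pr X.

Let D : set (config R S) := @nonneg_config R S.

(** Invariance is stated for events; [integral_mixture] extends it to the coordinate, the mean
    formula applies at each initial state, and Tonelli moves the integral inside K^m. *)
Lemma invariant_mean (mu : probability (config R S) R) (t : R) i :
  invariant_measure D Pr X mu -> (0 <= t)%R ->
  \int[mu]_(x in D) (x i)%:E = \esum_(m in [set: nat])
    ((poisson_weight 2 m t)%:E * iter m (kapply (lazy_kernel lam p))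
       (fun j => \int[mu]_(x in D) (x j)%:E) i).
Proof.
move=> [muD inv] t0; have mD : measurable D by exact: measurable_nonneg_config.
have K0 i' j' : (0 <= lazy_kernel lam p i' j')%R by exact: lazy_kernel_ge0.
pose f (y : config R S) : \bar R := (Num.max (y i) 0%R)%:E.
have mf : measurable_fun setT f.
  by apply/measurable_EFinP; apply: measurable_maxr => //; exact: measurable_coordinate.
have f0 y : 0 <= f y by rewrite lee_fin le_max lexx orbT.
have mkap B : measurable B -> measurable_fun D (fun x => Pr x (X t @^-1` B)).
  case: X_model => mp _ mB; apply: (mp_kernel mp).
  by rewrite -[_ @^-1` _]setTI; exact: (measurable_process X_model t0).
have mix := integral_mixture (rho := mu) (mu := mu) (Z := id) mD
  (measurable_process X_model t0) (@measurable_id _ _ _)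
  mkap (fun B mB => inv t B t0 mB) mf f0.
(* The mixture identity integrates over all configurations, the means over [D]; the difference is a
   null set. *)
have muDC : mu (~` D) = 0.
  apply: (etrans (probability_setC mu mD)).
  by rewrite [X in 1 - X](_ : _ = 1) ?subee.
transitivity (\int[mu]_(x in D) f x).
  by apply: eq_integral => x /[!inE] Dx; congr _%:E; apply/esym/max_idPl/Dx.
transitivity (\int[mu]_x f x).
  rewrite [RHS](ge0_negligible_integral (measurableC mD))//.
  by rewrite setDE setCK setTI.
rewrite mix.
transitivity (\int[mu]_(x in D) \esum_(m in [set: nat])
    ((poisson_weight 2 m t)%:E * iter m (kapply (lazy_kernel lam p))
       (fun j => (x j)%:E) i)).
  apply: eq_integral => x /[!inE] Dx.
  rewrite -(mean_formula p_rw lam01 nu_redistribution nu_mean X_model)//.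
  apply: eq_integral => w _; congr _%:E; apply/max_idPl.
  exact: (process_ge0 X_model).
have mx j : measurable_fun D (fun x : config R S => (x j)%:E).
  by apply/measurable_EFinP/measurable_funTS; exact: measurable_coordinate.
have x0 (x : config R S) j : D x -> 0 <= (x j)%:E.
  by move=> Dx; rewrite lee_fin; exact: Dx.
have mit m : measurable_fun D (fun x : config R S =>
    iter m (kapply (lazy_kernel lam p)) (fun j => (x j)%:E) i).
  exact: measurable_iter_kapply.
have it0 m (x : config R S) : D x ->
    0 <= iter m (kapply (lazy_kernel lam p)) (fun j => (x j)%:E) i.
  by move=> Dx; apply: iter_kapply_ge0 => // j; exact: x0.
have w0 m : 0 <= (poisson_weight 2 m t)%:E.
  by rewrite lee_fin poisson_weight_ge0.
rewrite integral_esum//.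
- apply: eq_esum => m _; rewrite ge0_integralZl//.
    by congr (_ * _); exact: integral_iter_kapply.
  by move=> x Dx; exact: it0.
- by move=> m; exact: measurable_funeM.
- by move=> m x Dx; rewrite mule_ge0// it0.
Qed.

End invariance.

(** * The mean identity and its stationary consequence *)

Theorem theorem6p1 (R : realType) (S : countType) (p : S -> S -> R) (lam : R)
    (nu : probability (measurableTypeR R) R)
    (p_rw : symmetric_rw p) (lam01 : 0 < lam < 1)
    (nu_redistribution : redistribution_measure nu)
    (nu_mean : 'E_nu[fun e : R => e]%E = (2^-1)%:E)
    (d : measure_display) (Om : measurableType d)
    (Pr : config R S -> probability Om R) (X : R -> Om -> config R S)
    (X_model : wealth_model p lam nu Pr X) :
  (forall (d' : measure_display) (Om' : measurableType d')
      (Q : S -> probability Om' R) (W : R -> Om' -> S),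
    continuous_time_walk p Q W ->
    forall (x : config R S) (i : S) (t : R), nonneg_config x -> 0 <= t ->
      'E_(Pr x)[fun w => X t w i]%E
        = 'E_(Q i)[fun w => x (W ((1 - lam) * t)%R w)]%E
      /\
      'E_(Q i)[fun w => x (W ((1 - lam) * t)%R w)]%E
        = \esum_(j in [set: S])
            (transition_probability Q W ((1 - lam) * t)%R i j * (x j)%:E)%E)
  /\
  (forall (mu : probability (config R S) R) (rho : S -> \bar R),
    invariant_measure (@nonneg_config R S) Pr X mu ->
    (forall i, rho i = \int[mu]_(x in @nonneg_config R S) (x i)%:E)%E ->
    (forall i, rho i < +oo)%E ->
    forall i, \esum_(j in [set: S]) ((p i j)%:E * rho j)%E = rho i).
Proof.
have [l0 l1] := andP lam01.
split.
  move=> d' Om' Q W [N [Y WNY]] x i t Dx t0.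
  have s0 : 0 <= (1 - lam) * t by rewrite mulr_ge0// subr_ge0 ltW.
  have walkE : ('E_(Q i)[fun w => x (W ((1 - lam) * t)%R w)] = \esum_(j in [set: S])
      (transition_probability Q W ((1 - lam) * t)%R i j * (x j)%:E))%E.
    rewrite unlock; apply: integral_countable_valued => // j.
    exact: (measurable_walk WNY).
  split=> //; rewrite walkE (esum_transition_probability p_rw WNY)//.
  rewrite unlock (mean_formula p_rw lam01 nu_redistribution nu_mean X_model)//.
  rewrite (poisson_mixture_lazy_kernel p_rw lam01)//.
  (* A rate 1 clock at time (1 - lam) t has the weights of a rate 1 - lam clock at time t. *)
  apply: eq_esum => m _; congr (_%:E * _)%E.
  by rewrite /poisson_weight mul1r.
move=> mu rho inv rhoE rho_fin i.
have rho0 j : (0 <= rho j)%E.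
  by rewrite rhoE; apply: integral_ge0 => x Dx; rewrite lee_fin; exact: Dx.
have K0 i' j' : 0 <= lazy_kernel lam p i' j' by exact: lazy_kernel_ge0.
have harm : kapply (lazy_kernel lam p) rho i = rho i.
  apply: (@poisson_stationary_harmonic _ _ _ K0 2) => // t j t0.
  rewrite (_ : rho = fun j => \int[mu]_(x in @nonneg_config R S) (x j)%:E)%E.
    exact: (invariant_mean p_rw lam01 nu_redistribution nu_mean X_model j inv t0).
  exact/funext.
have rfin j : rho j \is a fin_num by rewrite ge0_fin_numE.
have p0 i' j' : 0 <= p i' j' by case: p_rw.
have prho0 : (0 <= kapply p rho i)%E by exact: kapply_ge0.
move: harm; rewrite kapply_lazy_kernel// -[esum _ _]/(kapply p rho i).
rewrite -(fineK (rfin i)); have b0 : 0 < (1 - lam) / 2 by lra.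
(* K rho = rho with rho finite excludes P rho = +oo; in the finite case, (1 - lam)/2 is
   cancelled. *)
case: (kapply p rho i) prho0 => [r _| _|//].
  rewrite -!EFinM -EFinD => -[h]; congr _%:E.
  apply: (mulfI (_ : (1 - lam) / 2 != 0)); first by rewrite gt_eqF.
  lra.
by rewrite gt0_muley ?lte_fin// -EFinM.
Qed.
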